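(* Let $F$ be an algebraically closed field of characteristic zero, let $B$ be a finite dimensional simple Lie algebra over $F$, and let $L=F[G]\otimes B$ be the color Lie superalgebra with $G=\langle a\rangle_2\times\langle b\rangle_2\cong\mathbb{Z}_2\oplus\mathbb{Z}_2$, with the skew-symmetric bicharacter $\beta$ on $G$ determined by $\beta(a,a)=\beta(b,b)=1$, $\beta(a,b)=-1$, with $B$ trivially $G$-graded, and with product $$[a^ib^j\otimes x,\;a^kb^l\otimes y]=(-1)^{jk}a^{i+k}b^{j+l}\otimes[x,y],\qquad i,j,k,l\in\{0,1\},\ x,y\in B.$$ Then the limit $\mathrm{PI\text{-}exp}(L)=\lim_{n\to\infty}\sqrt[n]{c_n(L)}$ exists and equals $\dim L$ (where $c_n(L)$ are the ordinary, non-graded, codimensions of $L$).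
   Context: $\langle a\rangle_2$ denotes a cyclic group of order $2$ generated by $a$, and $F[G]$ is the group algebra, regarded here as a vector space with basis $G$. The algebra $L$ is $G$-graded by $\deg(g\otimes x)=g$; its product is the bilinear operation given in the claim (exponents of $a,b$ are read mod $2$ on the right-hand side), and $L$ is considered as a non-associative $F$-algebra. Let $F\{X\}$ be the absolutely free (non-associative, non-unital) $F$-algebra on the countable set $X=\{x_1,x_2,\ldots\}$. A polynomial $f(x_1,\ldots,x_n)\in F\{X\}$ is an identity of an $F$-algebra $A$ if $f(a_1,\ldots,a_n)=0$ for all $a_1,\ldots,a_n\in A$; $\mathrm{Id}(A)$ is the ideal of all identities of $A$. $P_n$ is the subspace of $F\{X\}$ of all multilinear polynomials in $x_1,\ldots,x_n$ (spanned by monomials containing each of $x_1,\dots,x_n$ exactly once, with all bracketings). The $n$th codimension is $c_n(A)=\dim P_n/(P_n\cap\mathrm{Id}(A))$. *)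

(* Defs.v *)
From HB Require Import structures.
From mathcomp Require Import all_boot all_order all_algebra.
From mathcomp Require Import finmap.
(* The notations of monalg are incompatible with those of MathComp-Analysis. *)
From mathcomp Require Import -(notations) monalg.
From mathcomp Require Import all_classical all_reals all_analysis.
From mathcomp Require Import ring.

Set Implicit Arguments.
Unset Strict Implicit.
Unset Printing Implicit Defensive.

Import Order.TTheory GRing.Theory Num.Theory.

Local Open Scope ring_scope.
Local Open Scope classical_set_scope.

(* Nonassociative monomials in the countable set of variables x_1, x_2, ...;
   [Var i] is x_(i+1). *)
Inductive magma : Type := Var of nat | Node of magma & magma.

Fixpoint magma_encode (m : magma) : GenTree.tree nat :=
  match m with
  | Var i => GenTree.Leaf i
  | Node m1 m2 => GenTree.Node 0 [:: magma_encode m1; magma_encode m2]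
  end.

Fixpoint magma_decode (t : GenTree.tree nat) : option magma :=
  match t with
  | GenTree.Leaf i => Some (Var i)
  | GenTree.Node _ [:: t1; t2] =>
      if (magma_decode t1, magma_decode t2) is (Some m1, Some m2)
      then Some (Node m1 m2) else None
  | _ => None
  end.

Lemma magma_encodeK : pcancel magma_encode magma_decode.
Proof. by elim=> //= m1 -> m2 ->. Qed.

HB.instance Definition _ := Choice.copy magma (pcan_type magma_encodeK).

Fixpoint leaves (m : magma) : seq nat :=
  match m with
  | Var i => [:: i]
  | Node m1 m2 => leaves m1 ++ leaves m2
  end.

(* The absolutely free (non-unital) algebra on the variables: the vector space
   with basis [magma], with the product extending [Node] bilinearly. *)
Notation freealg F := (malg magma F).

Section FreeAlgebra.
Variable F : fieldType.
Implicit Types f g : freealg F.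

Definition fvar (i : nat) : freealg F := mkmalgU (Var i) 1.

Definition fmul f g : freealg F :=
  \sum_(m <- msupp f) \sum_(m' <- msupp g)
    mkmalgU (Node m m') (mcoeff m f * mcoeff m' g).

Section Evaluation.
Variables (A : lmodType F) (mul : {bilinear A -> A -> A}).

Fixpoint mon_eval (a : nat -> A) (m : magma) : A :=
  match m with
  | Var i => a i
  | Node m1 m2 => mul (mon_eval a m1) (mon_eval a m2)
  end.

Definition eval (a : nat -> A) (f : freealg F) : A :=
  \sum_(m <- msupp f) mcoeff m f *: mon_eval a m.

Lemma eval_supp a f (s : seq magma) : uniq s -> {subset msupp f <= s} ->
  eval a f = \sum_(m <- s) mcoeff m f *: mon_eval a m.
Proof.
move=> us fs; rewrite /eval (bigID (mem (msupp f)) predT) /=.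
rewrite [X in _ + X]big1_seq ?addr0; last by move=> m /andP[/negP].
rewrite [RHS](bigID (mem (msupp f)) predT) /=.
rewrite [X in _ = _ + X]big1 ?addr0; last first.
  by move=> m /mcoeff_outdom ->; rewrite scale0r.
rewrite -big_filter -[RHS]big_filter; apply: perm_big.
rewrite uniq_perm ?filter_uniq ?fset_uniq // => m.
rewrite !mem_filter /=; apply/andP/andP => -[mf _]; split => //.
exact: fs.
Qed.

Lemma eval_is_linear a : linear (eval a).
Proof.
move=> c f g.
set s := undup (enum_fset (msupp f) ++ enum_fset (msupp g)
                ++ enum_fset (msupp (c *: f + g))).
have us : uniq s by exact: undup_uniq.
rewrite !(@eval_supp a _ s) //; try by
  move=> m mf; rewrite mem_undup !mem_cat mf ?orbT.
rewrite scaler_sumr -big_split /=; apply: eq_bigr => m _.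
by rewrite mcoeffD mcoeffZ scalerDl scalerA.
Qed.

HB.instance Definition _ a :=
  GRing.isLinear.Build F (freealg F) A _ (eval a) (eval_is_linear a).

Lemma eval_mon a m c : eval a (mkmalgU m c) = c *: mon_eval a m.
Proof.
rewrite (@eval_supp a _ [:: m]) //; last first.
  move=> m'; apply: contraLR; rewrite inE => nm.
  rewrite -mcoeff_eq0 mcoeffU [m == _]eq_sym.
  by rewrite (negbTE nm) mulr0n.
by rewrite big_seq1 mcoeffUU.
Qed.

Lemma eval_fvar a i : eval a (fvar i) = a i.
Proof. by rewrite eval_mon scale1r. Qed.

Lemma eval_fmul a f g : eval a (fmul f g) = mul (eval a f) (eval a g).
Proof.
rewrite /fmul linear_sum [in RHS]/eval linear_sumlz /=; apply: eq_bigr => m _.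
rewrite linear_sum linearZl_LR /= linear_sumr scaler_sumr /=.
by apply: eq_bigr => m' _; rewrite linearZr_LR eval_mon scalerA.
Qed.

(* Id(A) *)
Definition identities : set (freealg F) :=
  [set f | forall a : nat -> A, eval a f = 0].

End Evaluation.

(* P_n *)
Definition multilinear (n : nat) : set (freealg F) :=
  [set f | forall m, m \in msupp f -> perm_eq (leaves m) (iota 0 n)].

End FreeAlgebra.

Section QuotientDimension.
Variables (F : fieldType) (V : lmodType F).

Definition subspace (W : set V) : Prop :=
  W 0 /\ forall (a : F) (u v : V), W u -> W v -> W (a *: u + v).

(* The classes of [e 0], ..., [e (d - 1)] form a basis of P / W. *)
Definition basis_mod (P W : set V) (d : nat) (e : 'I_d -> V) : Prop :=
  [/\ forall i, P (e i),
      forall c : 'I_d -> F, W (\sum_i c i *: e i) -> forall i, c i = 0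
    & forall v, P v -> exists c : 'I_d -> F, W (v - \sum_i c i *: e i)].

Definition quot_dim (P W : set V) : nat :=
  xget 0%N [set d | exists e : 'I_d -> V, basis_mod P W e].

Lemma subspaceZ W a u : subspace W -> W u -> W (a *: u).
Proof. by move=> [W0 WD] Wu; rewrite -[_ *: _]addr0; exact: WD. Qed.

Lemma subspaceD W u v : subspace W -> W u -> W v -> W (u + v).
Proof. by move=> [W0 WD] Wu Wv; rewrite -[u]scale1r; exact: WD. Qed.

Lemma subspaceN W u : subspace W -> W u -> W (- u).
Proof. by move=> sW Wu; rewrite -scaleN1r; exact: subspaceZ. Qed.

Lemma subspace_sum W d (u : 'I_d -> V) :
  subspace W -> (forall i, W (u i)) -> W (\sum_i u i).
Proof.
move=> sW Wu; elim/big_ind: _ => //; first by case: sW.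
by move=> x y; exact: subspaceD.
Qed.

Lemma free_mod_le (W : set V) d k (e : 'I_d -> V) (s : 'I_k -> V) :
  subspace W ->
  (forall c : 'I_d -> F, W (\sum_i c i *: e i) -> forall i, c i = 0) ->
  (forall i, exists c : 'I_k -> F, W (e i - \sum_j c j *: s j)) ->
  (d <= k)%N.
Proof.
move=> sW fe /choice[M HM]; rewrite leqNgt; apply/negP => ltkd.
pose A : 'M[F]_(d, k) := \matrix_(i, j) M i j.
have : kermx A != 0.
  rewrite -mxrank_eq0 mxrank_ker -lt0n subn_gt0.
  exact: leq_ltn_trans (rank_leq_col A) ltkd.
case/rowV0Pn=> u /sub_kermxP uA /eqP; apply; apply/rowP => i; rewrite mxE.
apply: (fe (fun i => u 0 i)).
have -> : \sum_i u 0 i *: e i =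
    \sum_i u 0 i *: (e i - \sum_j M i j *: s j).
  under [RHS]eq_bigr do rewrite scalerBr.
  rewrite sumrB [X in _ - X](_ : _ = 0) ?subr0 //.
  under eq_bigr do rewrite scaler_sumr.
  rewrite exchange_big big1 //= => j _.
  under eq_bigr do rewrite scalerA.
  rewrite -scaler_suml; have /rowP/(_ j) := uA; rewrite !mxE.
  by under eq_bigr do rewrite mxE; move=> ->; rewrite scale0r.
by apply: subspace_sum => // j; exact: subspaceZ.
Qed.

Lemma basis_mod_dim_uniq (P W : set V) d d' (e : 'I_d -> V) (e' : 'I_d' -> V) :
  subspace W -> basis_mod P W e -> basis_mod P W e' -> d = d'.
Proof.
move=> sW [Pe fe se] [Pe' fe' se']; apply/eqP; rewrite eqn_leq; apply/andP.
split.
- by apply: (free_mod_le sW fe) => i; exact: se'.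
- by apply: (free_mod_le sW fe') => i; exact: se.
Qed.

Lemma basis_mod_exists (P W : set V) k (s : 'I_k -> V) :
  subspace W ->
  (forall v, P v -> exists c : 'I_k -> F, v = \sum_j c j *: s j) ->
  exists e : 'I_(quot_dim P W) -> V, basis_mod P W e.
Proof.
move=> sW Ps.
pose free d (e : 'I_d -> V) := (forall i, P (e i)) /\
  forall c : 'I_d -> F, W (\sum_i c i *: e i) -> forall i, c i = 0.
pose Q d := `[< exists e : 'I_d -> V, free d e >].
have Q0 : exists d, Q d.
  exists 0%N; apply/asboolP; exists (fun=> 0); split; first by case.
  by move=> c _ [].
have Qk d : Q d -> (d <= k)%N.
  move=> /asboolP[e [Pe fe]]; apply: (@free_mod_le W d k e s) => // i.
  have [c ->] := Ps _ (Pe i); exists c; rewrite subrr.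
  by case: sW.
case: (ex_maxnP Q0 Qk) => d /asboolP[e [Pe fe]] dmax.
suff be : basis_mod P W e.
  rewrite /quot_dim; set D := [set _ | _].
  exact: (@xgetPex _ 0%N D (ex_intro _ d (ex_intro _ e be))).
split=> // v Pv; apply: contrapT => nv.
have : Q d.+1.
  apply/asboolP; exists (fun i => if unlift ord0 i is Some j then e j else v).
  split; first by move=> i; case: unliftP.
  move=> c; rewrite big_ord_recl unlift_none.
  under eq_bigr do rewrite liftK.
  move=> Wc; have c0 : c ord0 = 0.
    apply/eqP/negP => /negP nc0; apply: nv.
    exists (fun i => - (c ord0)^-1 * c (lift ord0 i)).
    have := subspaceZ (c ord0)^-1 sW Wc.
    rewrite scalerDr scalerA mulVf // scale1r scaler_sumr.
    under eq_bigr do rewrite scalerA.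
    congr W; congr (_ + _); rewrite -sumrN; apply: eq_bigr => i _.
    by rewrite mulNr scaleNr opprK.
  move: Wc; rewrite c0 scale0r add0r => /fe cl i.
  by case: (unliftP ord0 i) => [j|] ->.
by move=> /dmax; rewrite ltnn.
Qed.

End QuotientDimension.

Section Codimension.
Variables (F : fieldType) (A : lmodType F) (mul : {bilinear A -> A -> A}).

Definition codim (n : nat) : nat :=
  quot_dim (@multilinear F n) (@multilinear F n `&` identities mul).

Lemma multilinear_subspace n : subspace (@multilinear F n).
Proof.
split; first by move=> m; rewrite msupp0 inE.
move=> a u v Pu Pv m; rewrite -mcoeff_neq0 mcoeffD mcoeffZ => nz.
have [mu|mu] := boolP (m \in msupp u); first exact: Pu.
apply: Pv; rewrite -mcoeff_neq0; apply: contra nz => /eqP ->.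
by rewrite (mcoeff_outdom mu) mulr0 addr0.
Qed.

Lemma multilinear_identities_subspace n :
  subspace (@multilinear F n `&` identities mul).
Proof.
have [P0 PD] := multilinear_subspace n.
split; first by split=> // a; rewrite linear0.
move=> a u v [Pu Iu] [Pv Iv]; split; first exact: PD.
by move=> x; rewrite linearP /= Iu Iv scaler0 addr0.
Qed.

Fixpoint monomials (n k : nat) : seq magma :=
  if k is k'.+1 then
    map Var (iota 0 n) ++
    [seq Node m m' | m <- monomials n k', m' <- monomials n k']
  else [::].

Lemma size_leaves_gt0 m : (0 < size (leaves m))%N.
Proof. by elim: m => //= m1 h1 m2 h2; rewrite size_cat ltn_addr. Qed.

Lemma mem_monomials n k m : (size (leaves m) <= k)%N ->
  {subset leaves m <= iota 0 n} -> m \in monomials n k.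
Proof.
elim: k m => [|k IH] [i|m1 m2] //=.
- rewrite size_cat leqn0 addn_eq0 => /andP[/eqP h].
  by have := size_leaves_gt0 m1; rewrite h.
- move=> _ h; rewrite mem_cat map_f // h //; exact: mem_head.
rewrite size_cat => le h; rewrite mem_cat allpairs_f ?orbT //; apply: IH.
- have := size_leaves_gt0 m2; move: le.
  by case: (size (leaves m2)) => // p; rewrite addnS ltnS => /(leq_trans _)->//;
     rewrite leq_addr.
- by move=> i hi; apply: h; rewrite mem_cat hi.
- have := size_leaves_gt0 m1; move: le.
  by case: (size (leaves m1)) => // p; rewrite addSn ltnS => /(leq_trans _)->//;
     rewrite leq_addl.
- by move=> i hi; apply: h; rewrite mem_cat hi orbT.
Qed.

Lemma codimP n : exists e : 'I_(codim n) -> freealg F,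
  basis_mod (@multilinear F n) (@multilinear F n `&` identities mul) e.
Proof.
pose s := undup (monomials n n).
apply: (@basis_mod_exists _ _ _ _ (size s)
  (fun i => mkmalgU (nth (Var 0) s i) 1)).
  exact: multilinear_identities_subspace.
move=> f Pf; exists (fun i => mcoeff (nth (Var 0) s i) f).
transitivity (\sum_(m <- s) mcoeff m f *: mkmalgU m (1 : F)); last first.
  by rewrite (big_nth (Var 0)) big_mkord.
apply/malgP => m; rewrite raddf_sum /=.
under eq_bigr do rewrite mcoeffZ mcoeffU.
have [ms|ms] := boolP (m \in s).
  rewrite (bigD1_seq m) ?undup_uniq //= eqxx mulr1 big1 ?addr0 // => m' nm.
  by rewrite (negbTE nm) mulr0.
rewrite big1_seq; last first.
  move=> m' /andP[_ m's]; case: eqP ms => [<-|_ _]; first by rewrite m's.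
  by rewrite mulr0.
apply: mcoeff_outdom; apply: contra ms => /Pf p.
rewrite mem_undup; apply: mem_monomials.
  by rewrite (perm_size p) size_iota.
by move=> i; rewrite (perm_mem p).
Qed.

Lemma codim_unique n d (e : 'I_d -> freealg F) :
  basis_mod (@multilinear F n) (@multilinear F n `&` identities mul) e ->
  codim n = d.
Proof.
move=> be; have [e' be'] := codimP n.
exact: basis_mod_dim_uniq (multilinear_identities_subspace n) be' be.
Qed.

End Codimension.

Definition is_lie (F : fieldType) (B : lmodType F)
    (br : {bilinear B -> B -> B}) : Prop :=
  (forall x, br x x = 0) /\
  (forall x y z, br x (br y z) + br y (br z x) + br z (br x y) = 0).

Definition lie_ideal (F : fieldType) (B : vectType F)
    (br : {bilinear B -> B -> B}) (I : {vspace B}) : Prop :=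
  forall x y, y \in I -> br x y \in I.

Definition is_simple_lie (F : fieldType) (B : vectType F)
    (br : {bilinear B -> B -> B}) : Prop :=
  [/\ is_lie br,
      exists x y, br x y != 0
    & forall I : {vspace B}, lie_ideal br I -> I = 0%VS \/ I = fullv].

HB.instance Definition _ (U V : finZmodType) := Finite.on (U * V)%type.

Section ColorLie.
Variables (F : fieldType) (G : finZmodType).

Definition bicharacter (beta : G -> G -> F) : Prop :=
  [/\ forall g h, beta g h != 0,
      forall g h k, beta (g + h) k = beta g k * beta h k
    & forall g h k, beta g (h + k) = beta g h * beta g k].

Definition skew_bicharacter (beta : G -> G -> F) : Prop :=
  bicharacter beta /\ forall g h, beta g h * beta h g = 1.

Definition is_grading (L : vectType F) (br : {bilinear L -> L -> L})
    (gr : G -> {vspace L}) : Prop :=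
  [/\ (\sum_g gr g)%VS = fullv,
      directv (\sum_g gr g)%VS
    & forall g h x y, x \in gr g -> y \in gr h -> br x y \in gr (g + h)].

Definition is_color_lie (beta : G -> G -> F) (L : vectType F)
    (br : {bilinear L -> L -> L}) (gr : G -> {vspace L}) : Prop :=
  [/\ is_grading br gr,
      forall g h x y, x \in gr g -> y \in gr h ->
        br x y = - (beta g h *: br y x)
    & forall g h x y z, x \in gr g -> y \in gr h ->
        br (br x y) z = br x (br y z) - beta g h *: br y (br x z)].

End ColorLie.

(* The group <a>_2 x <b>_2, written additively: a^i b^j is (i, j). *)
Notation Gab := ('Z_2 * 'Z_2)%type.
Definition ga : Gab := (1, 0).
Definition gb : Gab := (0, 1).

(* F[G] (x) B for a vector space B over F; u stands for \sum_g g (x) u g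
   (see [tens_decomp], and [tens_universal] for the universal property). *)
Notation FG_tensor B := {ffun Gab -> B}.

Section TensorGroupAlgebra.
Variables (F : fieldType) (B : vectType F).

Local Notation FGtensor := (FG_tensor B).

(* F[G] as a vector space *)
Local Notation FG := {ffun Gab -> F^o}.

Definition group_elt (g : Gab) : FG := [ffun h => (h == g)%:R].

Definition tens (c : FG) (x : B) : FGtensor := [ffun g => (c g : F) *: x].

Local Notation "g '#' x" := (tens (group_elt g) x) (at level 40).

Lemma tensE g x h : (g # x) h = if h == g then x else 0.
Proof. by rewrite !ffunE; case: eqP => _; rewrite ?scale1r ?scale0r. Qed.

Lemma tens_bilinear : bilinear_for *:%R *:%R (tens : FG -> B -> FGtensor).
Proof.
split=> [x c f g|c a x y]; apply/ffunP => h; rewrite !ffunE.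
  by rewrite scalerDl scalerA.
by rewrite scalerDr !scalerA mulrC.
Qed.

HB.instance Definition _ := bilinear_isBilinear.Build F FG B FGtensor _ _
  (tens : FG -> B -> FGtensor) tens_bilinear.

HB.instance Definition _ (c : FG) := GRing.isLinear.Build F B FGtensor _
  (tens c) (tens_bilinear.2 c).

Lemma tens_decomp (u : FGtensor) : u = \sum_g g # u g.
Proof.
apply/ffunP => h; rewrite sum_ffunE (bigD1 h) //= tensE eqxx big1 ?addr0 //.
by move=> g /negbTE; rewrite tensE eq_sym => ->.
Qed.

Lemma dim_FG_tensor : \dim {: FGtensor} = (4 * \dim {: B})%N.
Proof. by rewrite !dimvf /dim /= card_prod !card_ord. Qed.

Lemma group_elt_decomp (c : FG) : c = \sum_g (c g : F) *: group_elt g.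
Proof.
apply/ffunP => h; rewrite sum_ffunE (bigD1 h) //= !ffunE eqxx big1 ?addr0.
  by rewrite /GRing.scale /= mulr1.
by move=> g /negbTE; rewrite !ffunE eq_sym => ->; rewrite scaler0.
Qed.

(* The universal property of the tensor product. *)
Lemma tens_universal (V : lmodType F) (f : {bilinear FG -> B -> V}) :
  exists2 h : {linear FGtensor -> V}, (forall c x, h (tens c x) = f c x)
    & forall h' : {linear FGtensor -> V},
        (forall c x, h' (tens c x) = f c x) -> h' =1 h.
Proof.
pose h (u : FGtensor) := \sum_g f (group_elt g) (u g).
have hlin : linear h.
  move=> a u v; rewrite /h scaler_sumr -big_split; apply: eq_bigr => g _ /=.
  by rewrite !ffunE linearDr linearZr_LR.
pose hL := GRing.isLinear.Build F FGtensor V _ h hlin.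
pose H : {linear FGtensor -> V} := HB.pack h hL.
have Hf c x : H (tens c x) = f c x.
  rewrite {2}(group_elt_decomp c) linear_sumlz; apply: eq_bigr => g _.
  by rewrite ffunE linearZr_LR linearZl_LR.
exists H => // h' hf u; rewrite (tens_decomp u) !linear_sum.
by apply: eq_bigr => g _; rewrite hf Hf.
Qed.

Variable br : {bilinear B -> B -> B}.

(* The exponents j, k of (-1)^(j k) are read off representatives in {0, 1}. *)
Definition color_bracket (u v : FGtensor) : FGtensor :=
  \sum_(g : Gab) \sum_(h : Gab) (-1) ^+ (g.2 * h.1)%N *: ((g + h) # br (u g) (v h)).

Lemma color_bracket_bilinear : bilinear_for *:%R *:%R color_bracket.
Proof.
split=> [w a u v|w a u v]; rewrite /color_bracket /= scaler_sumr -big_split;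
  apply: eq_bigr => g _ /=; rewrite scaler_sumr -big_split;
  apply: eq_bigr => h _ /=.
  rewrite !ffunE linearDl linearZl_LR linearDr linearZr_LR /= scalerDr.
  by rewrite !scalerA [a * _]mulrC.
rewrite !ffunE linearDr linearZr_LR /= linearDr linearZr_LR /= scalerDr.
by rewrite !scalerA [a * _]mulrC.
Qed.

HB.instance Definition _ := bilinear_isBilinear.Build F FGtensor FGtensor
  FGtensor _ _ color_bracket color_bracket_bilinear.

Lemma color_bracket_pure (g h : Gab) x y :
  color_bracket (g # x) (h # y) =
  (-1) ^+ (g.2 * h.1)%N *: ((g + h) # br x y).
Proof.
rewrite /color_bracket (bigD1 g) //= [X in _ + X]big1 ?addr0; last first.
  move=> g' /negbTE ng; apply: big1 => h' _.
  by rewrite (tensE g) ng linear0l linear0r scaler0.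
rewrite (bigD1 h) //= big1 ?addr0; first by rewrite !tensE !eqxx.
by move=> h' /negbTE nh; rewrite (tensE h) nh linear0r linear0r scaler0.
Qed.

Lemma gabE i j : ga *+ i + gb *+ j = (i%:R, j%:R) :> Gab.
Proof.
have pE (x y : 'Z_2) n : (x, y) *+ n = (x *+ n, y *+ n) :> Gab.
  by elim: n => // n IH; rewrite !mulrS IH.
by rewrite /ga /gb !pE !mul0rn; congr (_, _); rewrite ?addr0 ?add0r.
Qed.

(* The defining formula of the product of L. *)
Lemma color_bracketE (i j k l : nat) x y :
  color_bracket ((ga *+ i + gb *+ j) # x) ((ga *+ k + gb *+ l) # y) =
  (-1) ^+ (j * k)%N *: ((ga *+ (i + k) + gb *+ (j + l)) # br x y).
Proof.
rewrite color_bracket_pure !mulrnDr addrACA; congr (_ *: _).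
rewrite !gabE /= !val_Zp_nat //.
by rewrite -signr_odd oddM !modn2 !oddb -oddM signr_odd.
Qed.

(* The bicharacter determined by beta(a,a) = beta(b,b) = 1, beta(a,b) = -1. *)
Definition color_beta (g h : Gab) : F := (-1) ^+ (g.1 * h.2 + g.2 * h.1)%N.

Let sgD (i j : 'Z_2) (n : nat) :
  (-1) ^+ ((i + j)%R * n) = (-1) ^+ (i * n) * (-1) ^+ (j * n) :> F.
Proof.
rewrite -exprD -mulnDl -signr_odd -[RHS]signr_odd !oddM; congr (_ ^+ (_ && _)).
by rewrite /= oddD modn2 oddb oddD.
Qed.

Lemma color_beta_skew : skew_bicharacter color_beta.
Proof.
split.
  split=> [g h|g h k|g h k]; first by rewrite signr_eq0.
    by rewrite /color_beta !exprD !sgD mulrACA.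
  rewrite /color_beta !exprD ![(g.1 * _)%N]mulnC ![(g.2 * _)%N]mulnC !sgD.
  by rewrite mulrACA.
by move=> g h; rewrite /color_beta -exprD [(h.2 * _)%N]mulnC
  [(h.1 * _)%N]mulnC [(g.2 * _ + _)%N]addnC -signr_odd addnn -mul2n oddM.
Qed.

Lemma color_beta_gens :
  [/\ color_beta ga ga = 1, color_beta gb gb = 1 & color_beta ga gb = -1].
Proof. by split. Qed.

Lemma color_beta_unique (beta : Gab -> Gab -> F) : skew_bicharacter beta ->
  beta ga ga = 1 -> beta gb gb = 1 -> beta ga gb = -1 ->
  forall g h, beta g h = color_beta g h.
Proof.
move=> [[nz Dl Dr] sk] aa bb ab [g1 g2] [h1 h2].
have ba : beta gb ga = -1.
  by have := sk ga gb; rewrite ab mulN1r => /(canRL opprK).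
have Ml g h n : beta (g *+ n) h = beta g h ^+ n.
  elim: n => [|n IH]; last by rewrite mulrS exprS Dl IH.
  rewrite expr0; apply: (mulIf (nz 0 h)).
  by rewrite mul1r -Dl addr0.
have Mr g h n : beta g (h *+ n) = beta g h ^+ n.
  elim: n => [|n IH]; last by rewrite mulrS exprS Dr IH.
  rewrite expr0; apply: (mulIf (nz g 0)).
  by rewrite mul1r -Dr addr0.
have gE (i j : 'Z_2) : (i, j) = ga *+ i + gb *+ j :> Gab.
  by rewrite gabE !natr_Zp.
rewrite [in LHS](gE g1 g2) [in LHS](gE h1 h2) !Dl !Dr !Ml !Mr aa bb ab ba.
by rewrite !expr1n mul1r mulr1 -!exprM -exprD mulnC [(h1 * _)%N]mulnC.
Qed.

(* deg (g (x) x) = g *)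
Definition color_component (g : Gab) : {vspace FGtensor} :=
  limg (linfun (tens (group_elt g))).

Lemma mem_color_component g u :
  reflect (exists x, u = g # x) (u \in color_component g).
Proof.
apply: (iffP memv_imgP) => [[x _ ->]|[x ->]]; exists x; rewrite ?memvf //.
  by rewrite lfunE.
by rewrite lfunE.
Qed.

Lemma color_component_grading : is_grading color_bracket color_component.
Proof.
split.
- apply/vspaceP => u; rewrite memvf (tens_decomp u); apply: memv_sumr => g _.
  by apply/mem_color_component; exists (u g).
- apply/directv_sum_independent => us Hus s0 g _.
  apply/ffunP => h; rewrite ffunE.
  have [gh|/negbTE gh] := eqVneq h g; last first.
    by have /mem_color_component[x ->] := Hus g isT; rewrite tensE gh.
  move/ffunP/(_ g): s0; rewrite sum_ffunE (bigD1 g) //= big1 ?addr0 ?ffunE.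
    by rewrite gh.
  move=> k /negbTE kg; have /mem_color_component[x ->] := Hus k isT.
  by rewrite tensE eq_sym kg.
- move=> g h _ _ /mem_color_component[x ->] /mem_color_component[y ->] /=.
  rewrite color_bracket_pure; apply: memvZ; apply/mem_color_component.
  by exists (br x y).
Qed.

Lemma color_bracket_color_lie : is_lie br ->
  is_color_lie color_beta color_bracket color_component.
Proof.
move=> [alt jac].
have anti x y : br x y = - br y x.
  apply/eqP; rewrite -addr_eq0; apply/eqP.
  by have := alt (x + y); rewrite linearDl !linearDr !alt /= addr0 add0r.
have sq n : (-1) ^+ n * (-1) ^+ n = 1 :> F by rewrite -expr2 sqrr_sign.
split; first exact: color_component_grading.
- move=> g h _ _ /mem_color_component[x ->] /mem_color_component[y ->] /=.
  rewrite !color_bracket_pure scalerA addrC anti linearNr /= scalerN.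
  congr (- (_ *: _)).
  by rewrite /color_beta exprD [(h.2 * _)%N]mulnC mulrAC sq mul1r.
move=> g h _ _ z /mem_color_component[x ->] /mem_color_component[y ->].
have jac' w : br (br x y) w = br x (br y w) - br y (br x w).
  move: (jac x y w); rewrite (anti w (br x y)) (anti w x) linearNr /=.
  by move/eqP; rewrite subr_eq0 => /eqP ->.
have sumE u (f : Gab -> FGtensor) :
    color_bracket u (\sum_k f k) = \sum_k color_bracket u (f k).
  exact: linear_sumr.
have ZE c u v : color_bracket u (c *: v) = c *: color_bracket u v.
  exact: linearZr_LR.
have ZEl c u v : color_bracket (c *: u) v = c *: color_bracket u v.
  exact: linearZl_LR.
rewrite /=; move: color_bracket_pure sumE ZE ZEl.
move: color_bracket => cb cbE sumE ZE ZEl.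
rewrite (tens_decomp z) /= !sumE scaler_sumr -sumrB.
apply: eq_bigr => k _.
rewrite !cbE ZEl !ZE !cbE !scalerA jac'.
rewrite linearB /= scalerBr -addrA [h + (g + k)]addrCA.
congr (_ *: _ - _ *: _).
  rewrite sgD [(g.2 * (h.1 + k.1)%R)%N]mulnC sgD.
  by rewrite [(h.1 * _)%N]mulnC [(k.1 * _)%N]mulnC; ring.
rewrite sgD [(h.2 * (g.1 + k.1)%R)%N]mulnC sgD /color_beta exprD.
rewrite [(k.1 * _)%N]mulnC -[LHS]mul1r.
rewrite -[X in X * _ = _](sq (g.1 * h.2)%N); ring.
Qed.

End TensorGroupAlgebra.

(* Main.v *)
(* Since b a = - a b in the twisted group algebra, L is the algebra
   M_2(F) (x) B.  It is simple, and the form tr(L_u L_v) of left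
   multiplications is nondegenerate, because the Killing form of B is.  Let A be
   an algebra of dimension d with these two properties.

   A multilinear map A^n -> A is determined by its values on a basis, so
   c_n <= d^(n+1).  For the lower bound, the multiplication algebra of A contains
   an operator of rank one, and composing it with multiplications gives a
   multilinear polynomial det(x_1, ..., x_d) g(y) that is not an identity.
   Replacing x_i by p (q x_i) and summing over i multiplies it by tr(L_p L_q)
   (Razmyslov), so after alternation it can be multiplied by det(P) det(Q) for
   any two blocks P, Q of d new variables.  Hence all products of determinants
   over a partition of the new variables into blocks are available.  To a
   sequence of words w_0, w_1, ... in which each letter 1, ..., d occurs N times
   we associate the partition whose blocks take the r-th occurrence of the letter
   i in w_(q+i); when the first d words are fixed, evaluation at the basis
   vectors spelled out by such sequences shows that these products are linearly
   independent.  There are about d^(dN) choices for each word, whence the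
   exponential rate d.

   That the Killing form is not zero is proved without Jordan decompositions:
   if it were, then for D the derivation acting on the generalized eigenspaces
   of ad x by an additive integer-valued function h of the eigenvalue, we would
   have tr(D ad x) = 0 as x is a sum of brackets.  Applying h to this trace, the
   sum of h(k) k over the eigenvalues k, gives that the h(k)^2 sum to zero.  So the
   eigenvalues are zero and all ad x are nilpotent, contradicting Engel's
   theorem. *)

From HB Require Import structures.
From mathcomp Require Import all_boot all_order all_fingroup all_algebra.
From mathcomp Require Import finmap.
From mathcomp Require Import -(notations) monalg.
From mathcomp Require Import all_classical all_reals all_analysis.
From mathcomp Require Import ring lra zify.
Require Import Defs.

Set Implicit Arguments.
Unset Strict Implicit.
Unset Printing Implicit Defensive.

Import Order.TTheory GRing.Theory Num.Theory numFieldNormedType.Exports.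

Local Open Scope ring_scope.

Import VectorInternalTheory.

(** * Ranks, subspaces and traces *)

(** Take a row-free family in [P] with as many rows as possible: a vector of [P] outside its row
    space could be appended to it. *)
Lemma row_free_max (K : fieldType) d (P : 'rV[K]_d -> Prop) :
  exists k (M : 'M[K]_(k, d)), [/\ row_free M, forall i, P (row i M)
    & forall r, P r -> (r <= M)%MS].
Proof.
pose Q k := `[< exists M : 'M[K]_(k, d), row_free M /\ forall i, P (row i M) >].
have Q0 : exists k, Q k.
  exists 0%N; apply/asboolP; exists 0; split; last by case.
  by rewrite /row_free mxrank0.
have Qd k : Q k -> (k <= d)%N.
  by case/asboolP=> M [/eqP Mk _]; rewrite -{1}Mk rank_leq_col.
case: (ex_maxnP Q0 Qd) => k /asboolP[M [Mfree PM]] kmax.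
exists k, M; split=> // r Pr; apply/negP => /negP rM.
have : Q (k + 1)%N; last by move/kmax; rewrite addn1 ltnn.
apply/asboolP; exists (col_mx M r); split; last first.
  by move=> i; case: (split_ordP i) => j ->; rewrite ?rowKu ?rowKd ?row_id.
apply: inj_row_free => v; rewrite -[v]hsubmxK mul_row_col => /eqP.
set v1 := lsubmx v; set v2 := rsubmx v; rewrite addr_eq0 => /eqP v12.
have v20 : v2 = 0.
  rewrite [v2]mx11_scalar; case: (eqVneq (v2 0 0) 0) => [->|nz].
    by rewrite -scalemx1 scale0r.
  case/negP: rM; apply/submxP; exists (- (v2 0 0)^-1 *: v1).
  rewrite -scalemxAl v12 scalerN scaleNr opprK [v2]mx11_scalar mul_scalar_mx.
  by rewrite mxE eqxx scalerA mulVf ?scale1r.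
rewrite v20 mul0mx oppr0 -(mul0mx _ M) in v12.
by rewrite (row_free_inj Mfree v12) v20 row_mx0.
Qed.

Lemma subspace_vspace (F : fieldType) (V : vectType F) (W : set V) :
  subspace W -> exists U : {vspace V}, forall v, v \in U <-> W v.
Proof.
move=> sW; have [k [M [_ WM maxM]]] := row_free_max (fun r => W (r2v r)).
exists (mx2vs M) => v; rewrite memvE /subsetv !genmxE; split; last first.
  by move=> Wv; apply: maxM; rewrite v2rK.
case/submxP=> c vE; rewrite -[v]v2rK vE mulmx_sum_row linear_sum.
apply: (subspace_sum sW) => i; rewrite linearZ.
by apply: (subspaceZ (c 0 i) sW); exact: WM.
Qed.

(** * Coordinates and traces of endomorphisms *)

Section Trace.
Variables (F : fieldType) (A : vectType F).

Definition ebase (i : 'I_(dim A)) : A := r2v (delta_mx 0 i).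

Lemma ebase_decomp (v : A) : v = \sum_i v2r v 0 i *: ebase i.
Proof.
rewrite -[LHS]v2rK [X in r2v X = _]row_sum_delta linear_sum.
by apply: eq_bigr => i _; rewrite linearZ.
Qed.

Lemma v2r_ebase i j : v2r (ebase i) 0 j = (i == j)%:R.
Proof. by rewrite r2vK mxE eqxx eq_sym. Qed.

Lemma v2r_comb (c : 'I_(dim A) -> F) i : v2r (\sum_j c j *: ebase j) 0 i = c i.
Proof.
rewrite linear_sum summxE (bigD1 i) //= big1 => [|j /negbTE ji].
  by rewrite linearZ mxE v2r_ebase eqxx mulr1 addr0.
by rewrite linearZ mxE v2r_ebase ji mulr0.
Qed.

(** Defined for bare functions, so that pointwise combinations of operators can be inserted
    directly; for linear [f] it is the usual trace. *)
Definition ltrace (f : A -> A) : F := \sum_i v2r (f (ebase i)) 0 i.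

(** The identity is the sum of the rank-one operators [v |-> l i v *: b i], and composing [f] with
    each of them contributes [l i (f (b i))]. *)
Lemma ltrace_frame (I : finType) (b : I -> A) (l : I -> A -> F)
    (f : {linear A -> A}) : (forall i, scalar (l i)) ->
  (forall v, v = \sum_i l i v *: b i) -> ltrace f = \sum_i l i (f (b i)).
Proof.
move=> llin bl.
pose L i : {linear A -> F^o} :=
  HB.pack (l i) (GRing.isLinear.Build F A F^o _ (l i) (llin i)).
transitivity (\sum_j \sum_i l i (ebase j) * v2r (f (b i)) 0 j).
  apply: eq_bigr => j _; rewrite {1}(bl (ebase j)) !linear_sum summxE.
  by apply: eq_bigr => i _; rewrite !linearZ mxE.
rewrite exchange_big; apply: eq_bigr => i _ /=.
rewrite -[RHS]/(L i (f (b i))) [in RHS](ebase_decomp (f (b i))) linear_sum.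
by apply: eq_bigr => j _; rewrite linearZ; exact: mulrC.
Qed.

Definition lmx (f : A -> A) : 'M[F]_(dim A) := lin1_mx (v2r \o f \o r2v).

Lemma mul_lmx (f : {linear A -> A}) v : v2r v *m lmx f = v2r (f v).
Proof. by rewrite mul_rV_lin1 /= v2rK. Qed.

Lemma ltraceE f : ltrace f = \tr (lmx f).
Proof. by apply: eq_bigr => i _; rewrite mxE. Qed.

Lemma lmx_comp (f g : {linear A -> A}) : lmx (f \o g) = lmx g *m lmx f.
Proof.
by apply/row_matrixP => i; rewrite !rowE mulmxA !mul_rV_lin1 /= v2rK.
Qed.

Lemma ltraceC (f g : {linear A -> A}) : ltrace (f \o g) = ltrace (g \o f).
Proof. by rewrite !ltraceE !lmx_comp mxtrace_mulC. Qed.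

Lemma eq_ltrace f g : f =1 g -> ltrace f = ltrace g.
Proof. by move=> fg; apply: eq_bigr => i _; rewrite fg. Qed.

Lemma ltraceD f g : ltrace (fun v => f v + g v) = ltrace f + ltrace g.
Proof. by rewrite -big_split; apply: eq_bigr => i _; rewrite linearD mxE. Qed.

Lemma ltraceZ a f : ltrace (fun v => a *: f v) = a * ltrace f.
Proof. by rewrite mulr_sumr; apply: eq_bigr => i _; rewrite linearZ mxE. Qed.

Lemma ltrace0 f : (forall v, f v = 0) -> ltrace f = 0.
Proof. by move=> f0; apply: big1 => i _; rewrite f0 linear0 mxE. Qed.

End Trace.

(** * Engel's theorem *)

Section Engel.
Variables (F : fieldType) (B : vectType F) (br : {bilinear B -> B -> B}).
Hypothesis lieB : is_lie br.

Lemma lieC x y : br x y = - br y x.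
Proof.
apply/eqP; rewrite -addr_eq0; apply/eqP; have [alt _] := lieB.
by have := alt (x + y); rewrite linearDl !linearDr !alt /= addr0 add0r.
Qed.

Lemma lie_jacobi x y z : br x (br y z) = br (br x y) z + br y (br x z).
Proof.
have [_ jac] := lieB; move: (jac x y z).
rewrite (lieC z x) linearNr (lieC z (br x y)) /= => /eqP.
by rewrite -addrA -opprD subr_eq0 addrC => /eqP.
Qed.

Definition ad_nilpotent x := exists k, forall v, iter k (br x) v = 0.

Hypothesis nilp : forall x, ad_nilpotent x.

Definition subalgebra (S : {vspace B}) :=
  forall x y, x \in S -> y \in S -> br x y \in S.
Definition lie_stable (S U : {vspace B}) :=
  forall x y, x \in S -> y \in U -> br x y \in U.

(** Induction on the dimension of [S], for all quotients [V / U] at once: [S] is a maximal proper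
    subalgebra [K] plus a line through some [z]; a vector killed by [K] modulo [U] is moved by
    powers of [z] to one killed by all of [S]. *)
Lemma engel_flag (S U V : {vspace B}) :
  subalgebra S -> (U <= V)%VS -> ~~ (V <= U)%VS ->
  lie_stable S U -> lie_stable S V ->
  exists v, [/\ v \in V, v \notin U & forall s, s \in S -> br s v \in U].
Proof.
move: {2}(\dim S).+1 (ltnSn (\dim S)) => n.
elim: n S U V => // n IH S U V dimS subS UV VU SU SV.
have [/eqP S0|Sn0] := boolP (S == 0%VS).
  case/subvPn: VU => v vV vU; exists v; split=> // s.
  by rewrite S0 memv0 => /eqP ->; rewrite linear0l mem0v.
pose Q k := `[< exists K : {vspace B},
  [/\ \dim K = k, (K <= S)%VS, (\dim K < \dim S)%N & subalgebra K] >].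
have Q0 : exists k, Q k.
  exists 0%N; apply/asboolP; exists 0%VS; rewrite dimv0 sub0v lt0n dimv_eq0.
  by split=> // x y; rewrite !memv0 => /eqP -> _; rewrite linear0l.
have Qd k : Q k -> (k <= \dim S)%N by case/asboolP=> K [<- _ /ltnW].
case: (ex_maxnP Q0 Qd) => k /asboolP[K [<- KS dimK subK]] maxK.
have SK : ~~ (S <= K)%VS.
  by apply: contraL dimK => /dimvS; rewrite -leqNgt.
have inS x : x \in K -> x \in S by move/subvP: KS; apply.
have ltK : (\dim K < n)%N by exact: leq_trans dimK dimS.
(* The induction hypothesis for [K] acting on [S / K] gives a [z] outside [K] that normalizes [K];
   then [K + <[z]>] is a subalgebra, equal to [S] by maximality. *)
have [|z [zS zK Kz]] := IH K K S ltK subK KS SK subK.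
  by move=> x y /inS; exact: subS.
have KzS : (K + <[z]>)%VS = S.
  apply/eqP; rewrite eqEdim subv_add KS -memvE zS /=.
  rewrite leqNgt; apply/negP => lt.
  have /maxK : Q (\dim (K + <[z]>)).
    apply/asboolP; exists (K + <[z]>)%VS; split=> //.
      by rewrite subv_add KS -memvE.
    move=> u v /memv_addP[x xK [_ /vlineP[a ->] ->]].
    case/memv_addP=> y yK [_ /vlineP[b ->] ->].
    rewrite linearDl !linearDr /= !linearZl_LR !linearZr_LR /=.
    have -> : br z z = 0 by case: lieB.
    rewrite !scaler0 addr0 (lieC z y).
    apply: (subvP (addvSl K <[z]>)).
    by rewrite !(memvD, memvZ) ?memvN ?(Kz x xK) ?(Kz y yK) ?subK.
  rewrite leqNgt => /negP; apply.
  rewrite ltn_neqAle dimvS ?addvSl // andbT.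
  by rewrite (dimv_leqif_sup (addvSl K <[z]>)) subv_add subvv -memvE.
pose W := (fun v => v \in V /\ forall x, x \in K -> br x v \in U) : set B.
have sW : subspace W.
  split; first by split=> [|x _]; rewrite ?linear0r mem0v.
  move=> a u v [uV Ku] [vV Kv]; split=> [|x xK]; first by rewrite memvD ?memvZ.
  by rewrite linearDr /= linearZr_LR memvD ?memvZ ?Ku ?Kv.
have [x y /inS|x y /inS|v0 [v0V v0U Kv0]] := IH K U V ltK subK UV VU.
- exact: SU.
- exact: SV.
(* By the Jacobi identity, since [br x z] stays in [K] for [x] in [K]. *)
have stepW v : W v -> W (br z v).
  move=> [vV Kv]; split=> [|x xK]; first exact: SV.
  by rewrite lie_jacobi memvD ?Kv ?Kz ?(SU z) ?Kv.
have iterW j : W (iter j (br z) v0) by elim: j => [|j] //=; exact: stepW.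
have [j0 zj0] := nilp z.
(* Nilpotency brings the iterates of [z] into [U]; the last one outside [U] is the required
   vector. *)
have exj : exists j, iter j (br z) v0 \in U by exists j0; rewrite zj0 mem0v.
case: (ex_minnP exj) => -[|j]; first by rewrite /= (negbTE v0U).
move=> zj minj; exists (iter j (br z) v0); have [jV Kj] := iterW j.
split=> //; first by apply/negP => /minj; rewrite ltnn.
move=> s; rewrite -KzS => /memv_addP[x xK [_ /vlineP[a ->] ->]].
by rewrite linearDl /= linearZl_LR memvD ?Kj ?memvZ.
Qed.

Lemma engel_center : (exists x : B, x != 0) ->
  exists2 v, v != 0 & forall x, br x v = 0.
Proof.
case=> x0 nz; have [|||x y _|x y _ _|v [_ v0 Bv]] :=
    @engel_flag fullv 0%VS fullv.
- by move=> x y _ _; exact: memvf.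
- exact: sub0v.
- by apply: contra nz => /subvP/(_ x0 (memvf x0)); rewrite memv0.
- by rewrite !memv0 => /eqP ->; rewrite linear0r.
- exact: memvf.
exists v => [|x]; first by rewrite memv0 in v0.
by apply/eqP; have := Bv x (memvf x); rewrite memv0.
Qed.

End Engel.

(** * Nondegeneracy of the Killing form *)

Section SpectralMapping.
Variables (F : closedFieldType) (n : nat) (A : 'M[F]_n.+1) (rs : seq F).
Hypothesis rsP : char_poly A = \prod_(x <- rs) ('X - x%:P).

Lemma size_char_roots : size rs = n.+1.
Proof.
by apply: succn_inj; rewrite -(size_char_poly A) rsP size_prod_XsubC.
Qed.

(** A nonzero [q] splits into linear factors and the determinant is multiplicative; for ['X - r] the
    determinant is, up to sign, the value of the characteristic polynomial at [r]. *)
Lemma det_horner_mx q : \det (horner_mx A q) = \prod_(x <- rs) q.[x].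
Proof.
have detX r : \det (horner_mx A ('X - r%:P)) = \prod_(x <- rs) (x - r).
  rewrite rmorphB /= horner_mx_X horner_mx_C -opprB -scaleN1r detZ.
  have -> : \det (r%:M - A) = (char_poly A).[r].
    rewrite -[RHS]/(horner_eval r (char_poly A)) -det_map_mx; congr (\det _).
    by apply/matrixP => i j; rewrite !mxE /= /horner_eval !hornerE hornerMn
      hornerX.
  rewrite rsP horner_prod -size_char_roots.
  elim: rs => [|x s IH]; first by rewrite !big_nil expr0 mul1r.
  rewrite !big_cons /= exprS -IH hornerXsubC /=; ring.
have [->|nz] := eqVneq q 0.
  have := size_char_roots; case: rs => // x s _.
  by rewrite rmorph0 det0 big_cons horner0 mul0r.
have [r ->] := closed_field_poly_normal q.
rewrite linearZ /= detZ rmorph_prod -{1}size_char_roots.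
under [RHS]eq_bigr do rewrite hornerZ horner_prod.
rewrite big_split /= big_const_seq count_predT iter_mulr_1; congr (_ * _).
elim: r => [|y r IH].
  by under [RHS]eq_bigr do rewrite big_nil; rewrite big_nil det1 big1.
under [RHS]eq_bigr do rewrite big_cons.
rewrite big_split /= big_cons detM IH detX; congr (_ * _).
by apply: eq_bigr => x _; rewrite !hornerE.
Qed.

(** By [det_horner_mx] for [c - p], the characteristic polynomial of [p(A)] and the product of the
    ['X - p.[x]] agree at every [c], hence coincide over an algebraically closed field. The trace is
    read off a coefficient. *)
Lemma trace_horner_mx p : \tr (horner_mx A p) = \sum_(x <- rs) p.[x].
Proof.
have charE : char_poly (horner_mx A p) =
    \prod_(y <- map (horner p) rs) ('X - y%:P).
  apply/eqP; rewrite -subr_eq0; apply/negP => /negP /closed_nonrootP[c].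
  rewrite /root hornerD hornerN subr_eq0 => /eqP; apply.
  have -> : (char_poly (horner_mx A p)).[c] = \det (horner_mx A (c%:P - p)).
    rewrite rmorphB /= horner_mx_C.
    rewrite -[LHS]/(horner_eval c (char_poly _)) -det_map_mx; congr (\det _).
    by apply/matrixP => i j; rewrite !mxE /= /horner_eval !hornerE hornerMn
      hornerX.
  rewrite det_horner_mx horner_prod big_map; apply: eq_bigr => x _.
  by rewrite !hornerE.
have := char_poly_trace (horner_mx A p) (ltn0Sn n); rewrite charE /=.
rewrite {1}(_ : n = (size (map (horner p) rs)).-1); last first.
  by rewrite size_map size_char_roots.
rewrite coefPn_prod_XsubC ?size_map ?size_char_roots //.
by rewrite big_map => /oppr_inj.
Qed.

End SpectralMapping.

(** * Chinese remainder theorem for powers of linear polynomials *)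

Lemma coprimep_prod_XsubC_exp (F : fieldType) (y : F) (s : seq F) (m k : nat) :
  y \notin s -> coprimep (('X - y%:P) ^+ m) (\prod_(x <- s) ('X - x%:P) ^+ k).
Proof.
move=> ys; rewrite big_seq; elim/big_ind: _ => [|u v|x xs].
- exact: coprimep1.
- by rewrite coprimepMr => -> ->.
apply: coprimep_expl; apply: coprimep_expr; apply: coprimep_XsubC2.
by rewrite subr_eq0; apply: contraNneq ys => <-.
Qed.

(** To add a node [y], correct [p] by a multiple of [Q], the product of the old moduli; Bezout makes
    [v * Q] congruent to 1 modulo the new one. *)
Lemma poly_crt (F : fieldType) (f : F -> F) (N : nat) (s : seq F) : uniq s ->
  exists p : {poly F}, forall x, x \in s -> ('X - x%:P) ^+ N %| p - (f x)%:P.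
Proof.
elim: s => [|y s IH] /=; first by exists 0.
case/andP=> ys /IH[p ps].
pose Q := \prod_(x <- s) ('X - x%:P) ^+ N.
have [[u v] /= uv] :=
  Bezout_eq1_coprimepP _ _ (coprimep_prod_XsubC_exp N N ys).
rewrite -/Q in uv.
exists (p + ((f y)%:P - p) * (v * Q)) => x; rewrite inE => /predU1P[->|xs].
  have -> : p + ((f y)%:P - p) * (v * Q) - (f y)%:P =
      (p - (f y)%:P) * u * ('X - y%:P) ^+ N.
    have -> : v * Q = 1 - u * ('X - y%:P) ^+ N by rewrite -uv; ring.
    by ring.
  exact: dvdp_mull.
rewrite addrAC dvdp_add ?ps // mulrA dvdp_mull // /Q (big_rem x) //=.
exact: dvdp_mulr.
Qed.

(** * Integer-valued additive functions in characteristic zero *)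

Lemma common_denominator k (v : 'I_k -> rat) :
  exists (D : int) (w : 'I_k -> int),
    D != 0 /\ forall i, D%:~R * v i = (w i)%:~R.
Proof.
exists (\prod_i denq (v i)).
exists (fun i => numq (v i) * \prod_(j | j != i) denq (v j)); split.
  by apply/prodf_neq0 => i _; rewrite denq_neq0.
by move=> i; rewrite (bigD1 i) //= !rmorphM /= numqE; ring.
Qed.

Lemma pchar0_intr_eq0 (F : fieldType) (z : int) :
  [pchar F] =i pred0 -> (z%:~R == 0 :> F) = (z == 0).
Proof.
move=> /pcharf0P F0; case: z => n; first exact: F0.
by rewrite NegzE mulrNz !oppr_eq0; exact: F0.
Qed.

(* h is a homomorphism to the integers from the group generated by the s i. *)
Lemma int_functional (F : fieldType) k (s : 'I_k -> F) (i0 : 'I_k) :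
  [pchar F] =i pred0 -> s i0 != 0 ->
  exists2 h : 'I_k -> int, h i0 != 0 &
    forall z : 'I_k -> int,
      \sum_i (z i)%:~R * s i = 0 -> \sum_i z i * h i = 0.
Proof.
move=> F0 s0.
pose P (r : 'rV[rat]_k) := exists2 z : 'I_k -> int,
  r = \row_i (z i)%:~R & \sum_i (z i)%:~R * s i = 0.
have [m [M [_ PM maxM]]] := row_free_max P.
(* The rows of [M] are integer relations among the [s i]. If they spanned this unit vector, clearing
   denominators would give [D%:~R * s i0 = 0] with [D] a nonzero integer. *)
have eM : ~~ ((delta_mx 0 i0 : 'rV[rat]_k) <= M)%MS.
  apply/negP => /submxP[c cM]; have [D [w [D0 Dw]]] := common_denominator (c 0).
  have /choice[Z ZP] : forall j, exists z : 'I_k -> int,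
      row j M = \row_i (z i)%:~R /\ \sum_i (z i)%:~R * s i = 0.
    by move=> j; have [z] := PM j; exists z.
  have wZ i : \sum_j w j * Z j i = D * (i == i0)%:R.
    apply: (@intr_inj rat); rewrite rmorph_sum rmorphM rmorph_nat /=.
    have /rowP/(_ i) := cM; rewrite !mxE eqxx /= => ->.
    rewrite mulr_sumr; apply: eq_bigr => j _; rewrite rmorphM /= -Dw -mulrA.
    by have [/rowP/(_ i) + _] := ZP j; rewrite !mxE => ->.
  have : D%:~R * s i0 = 0.
    transitivity (\sum_i (\sum_j w j * Z j i)%:~R * s i).
      rewrite (bigD1 i0) //= wZ eqxx mulr1 big1 ?addr0 // => i /negbTE ni.
      by rewrite wZ ni mulr0 mul0r.
    under eq_bigr do rewrite rmorph_sum mulr_suml.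
    rewrite exchange_big big1 //= => j _; have [_ Zj] := ZP j.
    under eq_bigr do rewrite rmorphM -mulrA.
    by rewrite -mulr_sumr Zj mulr0.
  by move/eqP; rewrite mulf_eq0 (negbTE s0) orbF pchar0_intr_eq0 // (negbTE D0).
(* Columns of the cokernel are orthogonal to all relations, and some column is nonzero at [i0];
   cleared of denominators it becomes [h]. *)
move: eM; rewrite submxE => /rV0Pn[j hj].
have [D [h [D0 Dh]]] := common_denominator (fun i => cokermx M i j).
exists h => [|z zs].
  rewrite -(intr_eq0 rat) -Dh mulf_neq0 ?intr_eq0 //; move: hj.
  by rewrite -rowE mxE.
have : P (\row_i (z i)%:~R) by exists z.
move/maxM; rewrite submxE => /eqP/rowP/(_ j); rewrite !mxE => zh.
apply: (@intr_inj rat); rewrite rmorph_sum /=.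
under eq_bigr do rewrite rmorphM /= -Dh mulrCA.
rewrite -mulr_sumr (_ : \sum_i _ = 0) ?mulr0 // -[RHS]zh.
by apply: eq_bigr => i _; congr (_ * _); rewrite mxE.
Qed.

Lemma int_functional_seq (F : fieldType) (S : seq F) (x0 : F) :
  [pchar F] =i pred0 -> x0 \in S -> x0 != 0 ->
  exists2 h : F -> int, h x0 != 0 &
    forall t : seq (int * F), all (fun c => c.2 \in S) t ->
      \sum_(c <- t) c.1%:~R * c.2 = 0 -> \sum_(c <- t) c.1 * h c.2 = 0.
Proof.
move=> F0 x0S x00; pose U := in_tuple (undup S).
have Uinj : injective (tnth U) by apply/tuple_uniqP; exact: undup_uniq.
have inU x : x \in S -> exists i, x = tnth U i.
  by rewrite -mem_undup => /(tnthP U).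
have [i0 x0E] := inU _ x0S.
have [|h hi0 hrel] := @int_functional F _ (tnth U) i0 F0; first by rewrite -x0E.
pose hF x := \sum_(i | tnth U i == x) h i.
have hFE i : hF (tnth U i) = h i.
  by rewrite /hF (big_pred1 i) // => j; rewrite (inj_eq Uinj).
exists hF => [|t tS t0]; first by rewrite x0E hFE.
have split_sum (R : nzRingType) (G : int -> F -> R) :
    \sum_(c <- t) G c.1 c.2 =
    \sum_i \sum_(c <- t | tnth U i == c.2) G c.1 (tnth U i).
  rewrite (exchange_big_dep predT) //= big_seq [RHS]big_seq.
  apply: eq_bigr => c /(allP tS)/inU[i ->].
  by rewrite (big_pred1 i) // => j; rewrite (inj_eq Uinj).
rewrite (split_sum _ (fun c x => c * hF x)).
transitivity (\sum_i (\sum_(c <- t | tnth U i == c.2) c.1) * h i).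
  apply: eq_bigr => i _; rewrite mulr_suml; apply: eq_bigr => c _.
  by rewrite hFE.
apply: hrel; rewrite -[RHS]t0 (split_sum _ (fun c x => c%:~R * x)).
by apply: eq_bigr => i _; rewrite rmorph_sum mulr_suml.
Qed.

(** Hides coordinates: [P p] is [p(T)], and [rs] lists the roots of the characteristic polynomial
    with multiplicity. Positive dimension makes the square matrices a nonzero ring. *)
Lemma poly_action (F : closedFieldType) (V : vectType F) (T : {linear V -> V}) :
  (0 < dim V)%N ->
  exists (P : {poly F} -> {linear V -> V}) (rs : seq F),
  [/\ forall v, P 1 v = v,
      forall v, P 'X v = T v,
      forall p q v, P (p * q) v = P p (P q v),
      forall c p q v, P (c *: p + q) v = c *: P p v + P q v
    & (forall p, ltrace (P p) = \sum_(x <- rs) p.[x]) /\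
      (forall v, P (\prod_(x <- rs) ('X - x%:P)) v = 0)].
Proof.
move=> dimV.
have [n [f [g [fK gK]]]] : exists n (f : {linear V -> 'rV[F]_n.+1})
    (g : {linear 'rV_n.+1 -> V}), cancel f g /\ cancel g f.
  pose f : {linear V -> 'rV[F]_(dim V)} := v2r.
  pose g : {linear 'rV[F]_(dim V) -> V} := r2v.
  have : cancel f g /\ cancel g f by split; [exact: v2rK | exact: r2vK].
  by move: f g; case: (dim V) dimV => // n _ f g ?; exists n, f, g.
pose A := lin1_mx (f \o T \o g).
have fT v : f v *m A = f (T v) by rewrite mul_rV_lin1 /= fK.
have [rs rsE] := closed_field_poly_normal (char_poly A).
rewrite (monicP (char_poly_monic A)) scale1r in rsE.
pose P p : {linear V -> V} := g \o mulmxr (horner_mx A p) \o f.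
exists P, rs; split=> [v|v|p q v|c p q v|].
- by rewrite /P /= rmorph1 mulmx1 fK.
- by rewrite /P /= horner_mx_X fT fK.
- by rewrite /P /= gK mulrC rmorphM /= mulmxA.
- by rewrite /P /= linearD linearZ /= mulmxDr linearD -scalemxAr linearZ.
split=> [p|v]; last first.
  by rewrite /P /= -rsE Cayley_Hamilton mulmx0 linear0.
rewrite (@ltrace_frame _ _ _ (fun i => g (delta_mx 0 i)) (fun i v => f v 0 i)).
- rewrite -(trace_horner_mx rsE) /mxtrace; apply: eq_bigr => i _ /=.
  by rewrite !gK -rowE mxE.
- by move=> i c u v; rewrite linearP !mxE.
- move=> v; rewrite -[LHS]fK [X in g X = _]row_sum_delta linear_sum.
  by apply: eq_bigr => i _; rewrite linearZ.
Qed.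

Definition derivation (F : fieldType) (B : lmodType F)
    (mul : {bilinear B -> B -> B}) (D : B -> B) :=
  forall u v, D (mul u v) = mul (D u) v + mul u (D v).

Lemma prod_XsubC_exp_dvd (F : fieldType) (s : seq F) (m : nat) (q : {poly F}) :
  uniq s -> (forall x, x \in s -> ('X - x%:P) ^+ m %| q) ->
  \prod_(x <- s) ('X - x%:P) ^+ m %| q.
Proof.
elim: s => [|y s IH] /=; first by rewrite big_nil dvd1p.
case/andP=> ys us sq; rewrite big_cons Gauss_dvdp.
  by rewrite sq ?mem_head // IH // => x xs; rewrite sq // inE xs orbT.
exact: coprimep_prod_XsubC_exp.
Qed.

(** The multiplicity of a root is at most [size rs], and the powers at distinct roots are
    coprime. *)
Lemma prod_XsubC_dvd (F : fieldType) (rs : seq F) (q : {poly F}) :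
  (forall x, x \in rs -> ('X - x%:P) ^+ (size rs) %| q) ->
  \prod_(x <- rs) ('X - x%:P) %| q.
Proof.
move=> rq; rewrite -big_undup_iterop_count /=.
apply: (@dvdp_trans _ (\prod_(x <- undup rs) ('X - x%:P) ^+ size rs)).
  elim/big_ind2: _ => [|p1 p2 q1 q2|x _]; first exact: dvdpp.
    exact: dvdp_mul.
  by rewrite -[iterop _ _ _ _]/(_ ^+ _) dvdp_exp2l ?count_size.
apply: prod_XsubC_exp_dvd; first exact: undup_uniq.
by move=> x; rewrite mem_undup; exact: rq.
Qed.

(* The operator acting on the generalized eigenspace of each eigenvalue x as
   the integer h x, for h additive on the eigenvalues, is a derivation D, and
   the trace of D T is the sum of the h x * x. *)
Lemma nilpotent_derivation (F : closedFieldType) (B : vectType F)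
    (mul : {bilinear B -> B -> B}) (T : {linear B -> B}) :
  [pchar F] =i pred0 -> derivation mul T ->
  (forall D : {linear B -> B}, derivation mul D -> ltrace (D \o T) = 0) ->
  exists k, forall v, iter k T v = 0.
Proof.
move=> F0 derT trT; have [dim0|dimB] := posnP (dim B).
  exists 0%N => v /=; apply: v2r_inj; rewrite linear0; apply/rowP=> -[i lt_i].
  by exfalso; move: lt_i; rewrite dim0.
have [P [rs [P1 PX PM PL [trP Prs]]]] := poly_action T dimB.
have PD p q v : P (p + q) v = P p v + P q v.
  by rewrite -{1}[p]scale1r PL scale1r.
have P0 v : P 0 v = 0.
  by apply: (addIr (P 1 v)); rewrite -PD !add0r.
have PC c v : P c%:P v = c *: v.
  by rewrite -[c%:P]addr0 -alg_polyC PL P1 P0 addr0.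
have Pdvd p q v : p %| q -> P p v = 0 -> P q v = 0.
  by case/dvdpP=> r -> pv; rewrite PM pv linear0.
have Prs0 q v :
    (forall x, x \in rs -> ('X - x%:P) ^+ size rs %| q) -> P q v = 0.
  by move/prod_XsubC_dvd/Pdvd; apply; exact: Prs.
have Psum (I : Type) (r : seq I) (p : I -> {poly F}) v :
    P (\sum_(i <- r) p i) v = \sum_(i <- r) P (p i) v.
  elim: r => [|i r IH]; first by rewrite !big_nil P0.
  by rewrite !big_cons PD IH.
set m := size rs in Prs0 *.
have PXC x v : P ('X - x%:P) v = T v - x *: v.
  by rewrite -polyCN PD PX PC scaleNr.
(* By the Leibniz rule, [T - (x + y)] on a product is [T - x] on the left factor plus [T - y] on the
   right one; so generalized eigenspaces multiply additively. *)
have mulP x y j k u v : P (('X - x%:P) ^+ j) u = 0 ->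
    P (('X - y%:P) ^+ k) v = 0 ->
    P (('X - (x + y)%:P) ^+ (j + k)) (mul u v) = 0.
  move: {2}(j + k)%N (erefl (j + k)%N) => n.
  elim: n j k u v => [|n IH] [|j] [|k] u v; rewrite ?expr0 ?P1 //.
  - by move=> _ -> _; rewrite linear0l.
  - by move=> _ -> _; rewrite linear0l linear0.
  - by move=> _ _ ->; rewrite linear0r linear0.
  move=> [jk] uj vk; rewrite addSnnS addnS exprSr PM PXC derT.
  have -> : mul (T u) v + mul u (T v) - (x + y) *: mul u v =
      mul (P ('X - x%:P) u) v + mul u (P ('X - y%:P) v).
    rewrite !PXC !linearBl !linearBr /= linearZl_LR linearZr_LR /= scalerDl.
    by rewrite opprD addrACA.
  rewrite linearD /= (IH j k.+1) -?PM -?exprSr ?add0r //.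
  by rewrite -addSnnS IH -?PM -?exprSr // addSnnS.
have [allz|/allPn[x0 x0rs x00]] := boolP (all (pred1 0) rs).
  exists m => v; have : P ('X ^+ m) v = 0.
    apply: Prs0 => x /(allP allz)/eqP ->; rewrite subr0; exact: dvdpp.
  suff -> : forall k v, P ('X ^+ k) v = iter k T v by [].
  by elim=> [|k IH] w; rewrite ?expr0 ?P1 // exprS PM PX IH.
exfalso.
(* Sums of two eigenvalues are included so that additivity of [h] on them is itself a relation
   inside [S]. *)
pose S := rs ++ [seq x + y | x <- rs, y <- rs].
have inS x : x \in rs -> x \in S by rewrite mem_cat => ->.
have inS2 x y : x \in rs -> y \in rs -> x + y \in S.
  by move=> xrs yrs; rewrite mem_cat; apply/orP; right; exact: allpairs_f.
have [h hx0 hrel] := int_functional_seq F0 (inS _ x0rs) x00.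
have hD x y : x \in rs -> y \in rs -> h (x + y) = h x + h y.
  move=> xrs yrs; have := hrel [:: (1, x); (1, y); (-1, x + y)].
  rewrite /= (inS x xrs) (inS y yrs) inS2 // => /(_ isT).
  rewrite !big_cons !big_nil /= !mul1r !mulN1r !addr0 addrA subrr => /(_ erefl).
  by rewrite addrA => /eqP; rewrite subr_eq0 => /eqP.
pose f x : F := (h x)%:~R.
(* [P p] is to act as [f x] on the generalized eigenspace of [x]; the exponent [m + m] covers
   products of two vectors killed by [m]-th powers. *)
have [p pS] := poly_crt f (m + m) (undup_uniq S).
have pf x : x \in S -> ('X - x%:P) ^+ (m + m) %| p - (f x)%:P.
  by move=> xS; apply: pS; rewrite mem_undup.
have PpE x v : x \in S -> P (('X - x%:P) ^+ (m + m)) v = 0 -> P p v = f x *: v.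
  move=> /pf xp /(Pdvd _ _ _ xp); rewrite -polyCN PD PC scaleNr.
  by move/eqP; rewrite subr_eq0 => /eqP.
have decomp v : exists2 w : F -> B, v = \sum_(x <- undup rs) w x &
    forall x, P (('X - x%:P) ^+ m) (w x) = 0.
  (* Chinese remainder idempotents: [P (e x)] projects onto the generalized eigenspace of [x]. *)
  have /choice[e eP] : forall x, exists e : {poly F}, forall y, y \in rs ->
      ('X - y%:P) ^+ m %| e - (y == x)%:R%:P.
    move=> x; have [e es] := poly_crt (fun y => (y == x)%:R) m (undup_uniq rs).
    by exists e => y yrs; apply: es; rewrite mem_undup.
  exists (fun x => P (e x) v) => [|x].
    rewrite -Psum -[LHS]P1; apply/esym/eqP; rewrite -subr_eq0 -scaleN1r.
    rewrite addrC -PL; apply/eqP; apply: Prs0 => y yrs.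
    have -> : -1 *: 1 + \sum_(x <- undup rs) e x =
        \sum_(x <- undup rs) (e x - (y == x)%:R%:P).
      rewrite sumrB addrC scaleN1r; congr (_ - _).
      rewrite (bigD1_seq y) ?undup_uniq ?mem_undup //= eqxx big1 ?addr0 //.
      by move=> x; rewrite eq_sym => /negbTE ->.
    by elim/big_ind: _ => [|? ?|x _]; rewrite ?dvdp0 ?eP //; exact: dvdp_add.
  rewrite -PM; apply: Prs0 => y yrs; have := eP x y yrs.
  have [->|_] := eqVneq y x; first by move=> _; exact: dvdp_mulr.
  by rewrite subr0; exact: dvdp_mull.
have derP : derivation mul (P p).
  move=> u v; have [wu -> wu0] := decomp u; have [wv -> wv0] := decomp v.
  have sumL (a : F -> B) w : mul (\sum_(x <- undup rs) a x) w =
    \sum_(x <- undup rs) mul (a x) w by exact: linear_sumlz.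
  have sumR w (a : F -> B) : mul w (\sum_(x <- undup rs) a x) =
    \sum_(x <- undup rs) mul w (a x) by exact: linear_sumr.
  rewrite [P p (\sum_(_ <- _) wu _)]linear_sum !sumL linear_sum -big_split.
  rewrite [LHS]big_seq [RHS]big_seq; apply: eq_bigr => x.
  rewrite mem_undup => xrs /=.
  rewrite [P p (\sum_(_ <- _) wv _)]linear_sum !sumR linear_sum -big_split.
  rewrite [LHS]big_seq [RHS]big_seq; apply: eq_bigr => y.
  rewrite mem_undup => yrs /=.
  have km z w : P (('X - z%:P) ^+ m) w = 0 -> P (('X - z%:P) ^+ (m + m)) w = 0.
    by move=> zw; rewrite exprD PM zw linear0.
  rewrite (PpE (x + y)) ?inS2 //; last exact: mulP.
  rewrite (PpE x (wu x)) ?inS ?km // (PpE y (wv y)) ?inS ?km //.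
  by rewrite linearZl_LR linearZr_LR -scalerDl /f hD // rmorphD.
have := trT (P p) derP.
have -> : ltrace (P p \o T) = \sum_(x <- rs) f x * x.
  transitivity (ltrace (P (p * 'X))).
    by apply: eq_ltrace => v; rewrite PM PX.
  rewrite trP big_seq [RHS]big_seq; apply: eq_bigr => x xrs.
  rewrite hornerMX; congr (_ * _); apply/eqP; rewrite -subr_eq0.
  have := pf x (inS x xrs); have : (0 < m + m)%N.
    by rewrite addn_gt0 /m; case: (rs) xrs.
  case: (m + m)%N => // k _; rewrite exprS.
  move/(dvdp_trans (dvdp_mulr _ (dvdpp _))).
  by rewrite dvdp_XsubCl /root !hornerE.
(* The vanishing trace is a relation with integer coefficients [h x]; applying [h] turns it into a
   vanishing sum of squares. *)
move=> tr0; have := hrel [seq (h x, x) | x <- rs].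
rewrite all_map !big_map /= => /(_ _ tr0).
have -> : all (preim (fun x => (h x, x)) (fun c => c.2 \in S)) rs.
  by apply/allP => x /inS.
move/(_ isT)/eqP; rewrite psumr_eq0 => [|x _]; last by rewrite -expr2 sqr_ge0.
by move/allP/(_ _ x0rs); rewrite /= mulf_eq0 orbb (negbTE hx0).
Qed.

(** * Simple Lie algebras and the invariance of the Killing form *)

Section SimpleLie.
Variables (F : fieldType) (B : vectType F) (br : {bilinear B -> B -> B}).
Hypothesis simpleB : is_simple_lie br.

Let lieB : is_lie br. Proof. by case: simpleB. Qed.

Lemma simple_lie_ideal (W : set B) : subspace W ->
  (forall x y, W y -> W (br x y)) -> (forall v, W v -> v = 0) \/ forall v, W v.
Proof.
move=> sW Wbr; have [U UW] := subspace_vspace sW; have [_ _ /(_ U)] := simpleB.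
case=> [x y /UW Wy|U0|Ufull]; first by apply/UW; exact: Wbr.
  by left=> v /UW; rewrite U0 memv0 => /eqP.
by right=> v; apply/UW; rewrite Ufull memvf.
Qed.

Lemma simple_lie_center v : v != 0 -> exists x, br x v != 0.
Proof.
move=> v0; apply: contrapT => /forallNP nv.
have [_ [x [y xy]] _] := simpleB.
have [|a b b0|W0|Wall] := @simple_lie_ideal (fun w => forall x, br x w = 0).
- split=> [x'|a u w u0 w0 x']; first exact: linear0r.
  by rewrite linearDr /= linearZr_LR /= u0 w0 scaler0 addr0.
- by move=> x'; rewrite b0 linear0r.
- case/eqP: v0; apply: W0 => x'; apply/eqP; apply: contrapT => /negP.
  exact: nv.
- by rewrite Wall eqxx in xy.
Qed.

(** An induction principle: the span of the brackets, obtained as the intersection [W'] of all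
    subspaces containing them, is a nonzero ideal. *)
Lemma simple_lie_perfect (W : set B) :
  subspace W -> (forall x y, W (br x y)) -> forall v, W v.
Proof.
move=> sW Wbr v; have [_ [x [y xy]] _] := simpleB.
pose W' := (fun w => forall U : set B,
  subspace U -> (forall x y, U (br x y)) -> U w) : set B.
have [||W0|Wall] := @simple_lie_ideal W'; last exact: Wall.
- split=> [U [] //|a u w Wu Ww U sU Ubr].
  by apply: sU.2; [exact: Wu | exact: Ww].
- by move=> x' y' _ U _; exact.
- by case/eqP: xy; apply: W0 => U _; exact.
Qed.

Definition killing x y := ltrace (br x \o br y).

Lemma killing_linear y : scalar (killing^~ y).
Proof.
move=> a u v; rewrite /killing -ltraceZ -ltraceD; apply: eq_ltrace => w /=.
by rewrite linearDl /= linearZl_LR.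
Qed.

Lemma ltrace_bracket (D : {linear B -> B}) x y :
  ltrace (D \o br (br x y)) =
  ltrace (D \o br x \o br y) - ltrace (D \o br y \o br x).
Proof.
rewrite -mulN1r -ltraceZ -ltraceD; apply: eq_ltrace => w /=.
by rewrite scaleN1r -linearB (lie_jacobi lieB x y w) addrK.
Qed.

Lemma killing_invariant z x y : killing (br z x) y = killing x (br y z).
Proof.
rewrite /killing ltraceC !ltrace_bracket; congr (_ - _).
  exact: (ltraceC (br y \o br z) (br x)).
exact: (ltraceC (br y) (br x \o br z)).
Qed.

End SimpleLie.

(** By invariance the radical is an ideal. Were it everything, [nilpotent_derivation] would make
    every [br z] nilpotent, and Engel's theorem would give a nonzero central element. *)
Lemma killing_nondegenerate (F : closedFieldType) (B : vectType F)
    (br : {bilinear B -> B -> B}) :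
  [pchar F] =i pred0 -> is_simple_lie br ->
  forall x, x != 0 -> exists y, killing br x y != 0.
Proof.
move=> F0 simpleB x x0; apply: contrapT => /forallNP xy0.
have lieB : is_lie br by case: simpleB.
have [|z u u0|W0|killing0] :=
    @simple_lie_ideal _ _ _ simpleB (fun u => forall y, killing br u y = 0).
- split=> [y|a u v u0 v0 y]; last by rewrite killing_linear u0 v0 mulr0 addr0.
  by apply: ltrace0 => w; exact: linear0l.
- by move=> y; rewrite killing_invariant.
- case/eqP: x0; apply: W0 => y; apply/eqP; apply: contrapT => /negP.
  exact: xy0.
have [|v v0 vB] := @engel_center _ _ _ lieB _ (ex_intro _ x x0); last first.
  by have [z] := simple_lie_center simpleB v0; rewrite vB eqxx.
move=> z; apply: (nilpotent_derivation (mul := br)) => // [u v|D derD].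
  exact: lie_jacobi.
move: z; apply: (simple_lie_perfect simpleB) => [|y z].
  split=> [|a u v u0 v0].
    by apply: ltrace0 => w /=; rewrite linear0l linear0.
  transitivity (a * ltrace (D \o br u) + ltrace (D \o br v)).
    rewrite -ltraceZ -ltraceD; apply: eq_ltrace => w /=.
    by rewrite linearDl /= linearZl_LR linearP.
  by rewrite u0 v0 mulr0 addr0.
rewrite (ltrace_bracket simpleB).
(* A derivation satisfies [D \o br z = br z \o D + br (D z)]. The first term cancels by cyclicity of
   the trace, the second gives a value of the Killing form. *)
have -> : ltrace (D \o br z \o br y) =
    ltrace (br z \o (D \o br y)) + killing br (D z) y.
  rewrite -ltraceD; apply: eq_ltrace => w /=.
  by rewrite derD addrC.
by rewrite killing0 addr0 ltraceC subrr.
Qed.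

(** * The color Lie superalgebra *)

Section ColorAlgebra.
Variables (F : fieldType) (B : vectType F) (br : {bilinear B -> B -> B}).

Local Notation L := (FG_tensor B).
Local Notation cb := (color_bracket br).
Local Notation "g '#' x" := (tens (group_elt F g) x) (at level 40).

Lemma gab_addK (g h : Gab) : g + h + h = g.
Proof.
by apply/eqP; case: g h => [[[|[|//]] ?] [[|[|//]] ?]]
  [[[|[|//]] ?] [[|[|//]] ?]].
Qed.

(** Only the component of [u] in degree [h - g] contributes, and [h - g = h + g] in this group. *)
Lemma color_bracketr u (g : Gab) x (h : Gab) :
  cb u (g # x) h = (-1) ^+ ((h + g)%R.2 * g.1)%N *: br (u (h + g)) x.
Proof.
rewrite {1}(tens_decomp u).
have -> : cb (\sum_k k # u k) (g # x) = \sum_k cb (k # u k) (g # x).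
  exact: linear_sumlz.
rewrite sum_ffunE (bigD1 (h + g)) //= big1 ?addr0 => [|k /negbTE kh].
  by rewrite color_bracket_pure !ffunE gab_addK eqxx scale1r.
rewrite color_bracket_pure !ffunE; case: eqP => [hk|_]; last first.
  by rewrite scale0r scaler0.
by rewrite hk gab_addK eqxx in kh.
Qed.

Lemma color_bracketl u (g : Gab) x (h : Gab) :
  cb (g # x) u h = (-1) ^+ (g.2 * (h + g)%R.1)%N *: br x (u (h + g)).
Proof.
rewrite {1}(tens_decomp u).
have -> : cb (g # x) (\sum_k k # u k) = \sum_k cb (g # x) (k # u k).
  exact: linear_sumr.
rewrite sum_ffunE (bigD1 (h + g)) //= big1 ?addr0 => [|k /negbTE kh].
  by rewrite color_bracket_pure !ffunE [g + _]addrC gab_addK eqxx scale1r.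
rewrite color_bracket_pure !ffunE; case: eqP => [hk|_]; last first.
  by rewrite scale0r scaler0.
by rewrite hk [g + k]addrC gab_addK eqxx in kh.
Qed.

Lemma big_gab (V : nmodType) (f : Gab -> V) :
  \sum_g f g = f (0, 0) + f (0, 1) + (f (1, 0) + f (1, 1)).
Proof.
rewrite (eq_bigr (fun g => f (g.1, g.2))); last by case.
rewrite -(pair_bigA _ (fun i j => f (i, j))) /= !big_ord_recl !big_ord0 !addr0.
by congr (f (_, _) + f (_, _) + (f (_, _) + f (_, _))); exact: val_inj.
Qed.

(** The exponent of the sign received by the component that ends in degree [k] after right
    multiplication by [g # y] and left multiplication by [g # x]. *)
Let chi (k g : Gab) := (g.2 * (k + g)%R.1 + k.2 * g.1)%N.

(** In the product the part quadratic in [g] cancels and a character of the group remains, trivial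
    exactly when [h = k]. *)
Lemma color_sign_orth (h k : Gab) :
  \sum_(g : Gab) (-1) ^+ chi k g * (-1) ^+ chi h g = (h == k)%:R *+ 4 :> F.
Proof.
pose p := odd (h.1 + k.1)%N; pose q := odd (h.2 + k.2)%N.
have chiE g : (-1) ^+ chi k g * (-1) ^+ chi h g =
    (-1) ^+ (p && odd g.2 (+) q && odd g.1) :> F.
  rewrite -exprD -signr_odd; congr (_ ^+ nat_of_bool _); rewrite /p /q /chi.
  by case: h k g {p q} => [[[|[|//]] ?] [[|[|//]] ?]]
    [[[|[|//]] ?] [[|[|//]] ?]] [[[|[|//]] ?] [[|[|//]] ?]].
have -> : (h == k) = ~~ p && ~~ q.
  by rewrite /p /q; case: h k {p q chiE} => [[[|[|//]] ?] [[|[|//]] ?]]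
    [[[|[|//]] ?] [[|[|//]] ?]].
rewrite (eq_bigr _ (fun g _ => chiE g)) big_gab /= !andbF !andbT.
by case: (p) (q) => -[]; rewrite /= !(expr0, expr1); ring.
Qed.

Hypothesis F0 : [pchar F] =i pred0.

Lemma four_neq0 : 4%:R != 0 :> F.
Proof. by move/pcharf0P: F0 => ->. Qed.

Hypothesis simpleB : is_simple_lie br.

(** A nonzero member of an ideal yields a nonzero homogeneous one; simplicity of [B] then gives a
    whole component, and as [B] is perfect, products with it fill the others. *)
Lemma color_bracket_simple (W : set L) : subspace W ->
  (forall u v, W v -> W (cb u v) /\ W (cb v u)) ->
  (forall v, W v -> v = 0) \/ (forall v, W v).
Proof.
move=> sW Wcb; have [W0|/existsNP[u /not_implyP[Wu u0]]] :=
  pselect (forall v, W v -> v = 0); first by left.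
right; have sum_W (I : finType) (f : I -> L) :
    (forall i, W (f i)) -> W (\sum_i f i).
  move=> Wf; elim/big_ind: _ => //; first exact: sW.1.
  by move=> *; exact: subspaceD.
have [k uk0] : exists k, u k != 0.
  apply: contrapT => /forallNP uk; apply: u0; apply/ffunP => k.
  by rewrite ffunE; apply/eqP/negPn/negP; exact: uk.
have lieB : is_lie br by case: simpleB.
have [y yu] := simple_lie_center simpleB uk0.
rewrite (lieC lieB) oppr_eq0 in yu.
have [x xyu] := simple_lie_center simpleB yu.
(* Summing over [g] with the signs belonging to [k] cancels every component except that of degree
   [k]. *)
have Wk : W (k # (br x (br (u k) y) *+ 4)).
  have -> : k # (br x (br (u k) y) *+ 4) =
      \sum_g (-1) ^+ chi k g *: cb (g # x) (cb u (g # y)).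
    apply/ffunP => h; rewrite tensE sum_ffunE.
    transitivity ((\sum_g (-1) ^+ chi k g * (-1) ^+ chi h g) *:
        br x (br (u h) y)).
      rewrite color_sign_orth; case: eqP => [->|_].
        by rewrite -mulr_natl mulr1 scaler_nat.
      by rewrite mul0rn scale0r.
    rewrite scaler_suml; apply: eq_bigr => g _.
    rewrite ffunE color_bracketl color_bracketr gab_addK linearZr_LR.
    by rewrite 2!scalerA -mulrA; congr ((_ * _) *: _); exact: exprD.
  apply: sum_W => g; apply: subspaceZ => //.
  by apply: (Wcb _ _ _).1; exact: (Wcb _ _ Wu).2.
have pureB g z : W (g # z) -> forall w, W (g # br w z).
  move=> Wz w; have -> : g # br w z = cb (0 # w) (g # z).
    by rewrite color_bracket_pure add0r scale1r.
  exact: (Wcb _ _ Wz).1.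
have sWg g : subspace (fun z => W (g # z)).
  split=> [|a z w Wz Ww]; first by rewrite linear0; exact: sW.1.
  by rewrite linearP; exact: sW.2.
have pure_all g z : W (g # z) -> z != 0 -> forall w, W (g # w).
  move=> Wz z0; have [a w|W0|//] := simple_lie_ideal simpleB (sWg g).
    by move/pureB; exact.
  by rewrite (W0 z Wz) eqxx in z0.
have Wkall : forall w, W (k # w).
  apply: pure_all Wk _; rewrite -scaler_nat scaler_eq0 negb_or four_neq0.
  by [].
have Wall g w : W (g # w).
  move: w; apply: (simple_lie_perfect simpleB) => // a w.
  have -> : g # br a w =
      (-1) ^+ ((g + k)%R.2 * k.1)%N *: cb ((g + k) # a) (k # w).
    by rewrite color_bracket_pure gab_addK scalerA -expr2 sqrr_sign scale1r.
  by apply: subspaceZ => //; exact: (Wcb _ _ (Wkall w)).1.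
by move=> v; rewrite (tens_decomp v); exact: sum_W.
Qed.

Lemma ltrace_color (f : {linear L -> L}) :
  ltrace f = \sum_g ltrace (fun x => f (g # x) g).
Proof.
rewrite (@ltrace_frame _ _ _ (fun p : Gab * 'I_(dim B) => p.1 # ebase p.2)
  (fun p w => v2r (w p.1) 0 p.2)) => [|p a u v|v].
- by rewrite -(pair_bigA _ (fun g i => v2r (f (g # ebase i) g) 0 i)).
- by rewrite !ffunE linearP !mxE.
rewrite -(pair_bigA _ (fun g i => v2r (v g) 0 i *: (g # ebase i))) /=.
rewrite [LHS]tens_decomp; apply: eq_bigr => g _.
rewrite {1}(ebase_decomp (v g)) linear_sum; apply: eq_bigr => i _.
by rewrite linearZ.
Qed.

End ColorAlgebra.

(** Take [v] homogeneous of a degree [k] with [u k] nonzero: each of the four components contributes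
    the same signed Killing value, so the trace is four times it. *)
Lemma color_trace_nondegenerate (F : closedFieldType) (B : vectType F)
    (br : {bilinear B -> B -> B}) :
  [pchar F] =i pred0 -> is_simple_lie br ->
  forall u : FG_tensor B, u != 0 ->
  exists v, ltrace (color_bracket br u \o color_bracket br v) != 0.
Proof.
move=> F0 simpleB u u0.
have [k uk0] : exists k, u k != 0.
  apply: contrapT => /forallNP uk; case/eqP: u0; apply/ffunP => k.
  by rewrite ffunE; apply/eqP/negPn/negP; exact: uk.
have [y ky] := killing_nondegenerate F0 simpleB uk0.
exists (tens (group_elt F k) y).
pose cb : {bilinear FG_tensor B -> FG_tensor B -> FG_tensor B} :=
  color_bracket br.
rewrite (ltrace_color (cb u \o cb _)) /cb /=.
have E g : ltrace (fun x => color_bracket br u (color_bracket br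
    (tens (group_elt F k) y) (tens (group_elt F g) x)) g) =
    (-1) ^+ (k.2 * k.1)%N * killing br (u k) y.
  rewrite -ltraceZ; apply: eq_ltrace => x /=.
  rewrite color_bracket_pure.
  have -> : color_bracket br u ((-1) ^+ (k.2 * g.1)%N *:
      tens (group_elt F (k + g)) (br y x)) = (-1) ^+ (k.2 * g.1)%N *:
      color_bracket br u (tens (group_elt F (k + g)) (br y x)).
    exact: linearZr_LR.
  rewrite ffunE color_bracketr [g + (k + g)]addrC gab_addK.
  rewrite scalerA -exprD; congr (_ *: _).
  rewrite -signr_odd -[RHS]signr_odd; congr (_ ^+ nat_of_bool _).
  by case: k g {ky uk0} => [[[|[|//]] ?] [[|[|//]] ?]]
    [[[|[|//]] ?] [[|[|//]] ?]].
rewrite big_gab !E -!mulr2n -mulrnA -mulr_natl !mulf_neq0 ?signr_eq0 //.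
exact: four_neq0.
Qed.

(** * Functions realized by multilinear polynomials *)

Section Realizable.
Variables (F : fieldType) (A : vectType F) (mul : {bilinear A -> A -> A}).
Implicit Types (a b : nat -> A) (s : seq nat) (Phi Psi : (nat -> A) -> A).

Definition upd a i v := fun j => if j == i then v else a j.

Lemma updE a i v : upd a i v i = v.
Proof. by rewrite /upd eqxx. Qed.

Lemma upd_id a i : upd a i (a i) = a.
Proof. by apply/funext => j; rewrite /upd; case: eqP => // ->. Qed.

Definition multilin (V : lmodType F) s (Phi : (nat -> A) -> V) :=
  forall i, i \in s -> forall a c u v,
    Phi (upd a i (c *: u + v)) = c *: Phi (upd a i u) + Phi (upd a i v).

(** Variables are expanded in the basis one at a time; [t] lists those still allowed arbitrary
    values. *)
Lemma multilin_vanish (V : lmodType F) s (Phi : (nat -> A) -> V) :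
  multilin s Phi ->
  (forall a, (forall j, j \in s -> exists k, a j = ebase k) -> Phi a = 0) ->
  forall a, Phi a = 0.
Proof.
move=> mPhi Phi0.
suff H (t : seq nat) : {subset t <= s} -> forall a,
    (forall j, j \in s -> j \notin t -> exists k, a j = ebase k) -> Phi a = 0.
  by move=> a; apply: (H s) => // j ->.
elim: t => [|i t IH] ts a at_; first by apply: Phi0 => j js; exact: at_.
have is_ : i \in s by apply: ts; exact: mem_head.
pose L u := Phi (upd a i u).
have Llin : linear L by move=> c u v; exact: mPhi.
pose LL : {linear A -> V} := HB.pack L (GRing.isLinear.Build F A V _ L Llin).
rewrite -(upd_id a i) -[LHS]/(LL (a i)) (ebase_decomp (a i)) linear_sum.
rewrite big1 // => k _.
rewrite linearZ /= [L _]IH ?scaler0 // => [j jt|j js jt].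
  by apply: ts; rewrite inE jt orbT.
rewrite /upd; case: eqP => [_|/eqP ji]; first by exists k.
by apply: at_; rewrite // inE negb_or ji.
Qed.

Lemma mon_eval_local a b m : {in leaves m, a =1 b} ->
  mon_eval mul a m = mon_eval mul b m.
Proof.
elim: m => [i|m1 IH1 m2 IH2] /= ab; first by apply: ab; exact: mem_head.
by rewrite IH1 ?IH2 // => i im; apply: ab; rewrite mem_cat im ?orbT.
Qed.

Lemma mon_eval_upd_out a i v m : i \notin leaves m ->
  mon_eval mul (upd a i v) m = mon_eval mul a m.
Proof.
move=> im; apply: mon_eval_local => j jm; rewrite /upd.
by case: eqP => // ji; rewrite -ji jm in im.
Qed.

Lemma mon_eval_multilin m : uniq (leaves m) ->
  multilin (leaves m) (fun a => mon_eval mul a m).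
Proof.
elim: m => [i|m1 IH1 m2 IH2] /=; first by move=> _ j; rewrite inE => /eqP -> *;
  rewrite !updE.
rewrite cat_uniq => /and3P[u1 /hasPn n12 u2] i + a c u v.
rewrite mem_cat => /orP[im|im].
  have im2 : i \notin leaves m2 by apply: contraL im => /n12.
  by rewrite !(mon_eval_upd_out _ _ im2) (IH1 u1 i im) linearDl /= linearZl_LR.
rewrite !(mon_eval_upd_out _ _ (n12 i im)) (IH2 u2 i im) linearDr /=.
by rewrite linearZr_LR.
Qed.

Fixpoint msubst (sig : nat -> magma) (m : magma) : magma :=
  match m with
  | Var i => sig i
  | Node m1 m2 => Node (msubst sig m1) (msubst sig m2)
  end.

Lemma mon_eval_msubst a sig m :
  mon_eval mul a (msubst sig m) =
  mon_eval mul (fun i => mon_eval mul a (sig i)) m.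
Proof. by elim: m => //= m1 -> m2 ->. Qed.

Lemma leaves_msubst sig m :
  leaves (msubst sig m) = flatten [seq leaves (sig i) | i <- leaves m].
Proof.
elim: m => [i|m1 IH1 m2 IH2] /=; first by rewrite cats0.
by rewrite IH1 IH2 map_cat flatten_cat.
Qed.

(** Evaluation functions stand for polynomials modulo identities; every monomial uses exactly the
    variables in [s], counted with multiplicity. *)
Definition realizable s Phi := exists2 l : seq (F * magma),
  all (fun p => perm_eq (leaves p.2) s) l &
  forall a, Phi a = \sum_(p <- l) p.1 *: mon_eval mul a p.2.

Lemma realizable_mon m : realizable (leaves m) (fun a => mon_eval mul a m).
Proof.
exists [:: (1, m)] => [|a] /=; first by rewrite perm_refl.
by rewrite big_seq1 scale1r.
Qed.

Lemma realizable_perm s s' Phi : perm_eq s s' ->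
  realizable s Phi -> realizable s' Phi.
Proof.
move=> ss' [l ls lE]; exists l => //; apply/allP => p /(allP ls)/perm_trans.
exact.
Qed.

Lemma realizable_eq s Phi Psi :
  Phi =1 Psi -> realizable s Phi -> realizable s Psi.
Proof. by move=> PP [l ls lE]; exists l => // a; rewrite -PP. Qed.

Lemma realizableZ s c Phi : realizable s Phi ->
  realizable s (fun a => c *: Phi a).
Proof.
case=> l ls lE; exists [seq (c * p.1, p.2) | p <- l]; first by rewrite all_map.
move=> a; rewrite lE big_map scaler_sumr; apply: eq_bigr => p _.
by rewrite scalerA.
Qed.

Lemma realizableD s Phi Psi : realizable s Phi -> realizable s Psi ->
  realizable s (fun a => Phi a + Psi a).
Proof.
case=> l ls lE [l' ls' lE']; exists (l ++ l'); first by rewrite all_cat ls.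
by move=> a; rewrite big_cat lE lE'.
Qed.

Lemma realizable_sum s (I : finType) (Phi : I -> (nat -> A) -> A) :
  (forall i, realizable s (Phi i)) -> realizable s (fun a => \sum_i Phi i a).
Proof.
move=> rPhi; elim: (index_enum I) => [|i r IH].
  by exists [::] => // a; rewrite !big_nil.
apply: (realizable_eq (Phi := fun a => Phi i a + \sum_(j <- r) Phi j a)).
  by move=> a; rewrite big_cons.
exact: realizableD.
Qed.

Lemma realizable_subst s Phi (sig : nat -> magma) : realizable s Phi ->
  realizable (flatten [seq leaves (sig i) | i <- s])
    (fun a => Phi (fun i => mon_eval mul a (sig i))).
Proof.
case=> l ls lE; exists [seq (p.1, msubst sig p.2) | p <- l].
  rewrite all_map; apply/allP => p /(allP ls) /= ps.
  by rewrite leaves_msubst; apply: perm_flatten; exact: perm_map.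
move=> a; rewrite lE big_map; apply: eq_bigr => p _ /=.
by rewrite mon_eval_msubst.
Qed.

Lemma realizable_rename s Phi (rho : nat -> nat) : realizable s Phi ->
  realizable (map rho s) (fun a => Phi (a \o rho)).
Proof.
move/(realizable_subst (Var \o rho)); congr (realizable _ _).
by elim: s => //= i s ->.
Qed.

Lemma realizable_local s Phi a b : realizable s Phi -> {in s, a =1 b} ->
  Phi a = Phi b.
Proof.
case=> l ls lE ab; rewrite !lE big_seq [RHS]big_seq; apply: eq_bigr => p.
move/(allP ls) => ps; congr (_ *: _); apply: mon_eval_local => i.
by rewrite (perm_mem ps) => /ab.
Qed.

Lemma realizable_multilin s Phi : uniq s -> realizable s Phi -> multilin s Phi.
Proof.
move=> us [l ls lE] i is_ a c u v; rewrite !lE scaler_sumr -big_split.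
rewrite big_seq [RHS]big_seq; apply: eq_bigr => p /(allP ls) ps /=.
rewrite (@mon_eval_multilin p.2) ?(perm_uniq ps) ?(perm_mem ps) //.
by rewrite scalerDr !scalerA mulrC.
Qed.

Lemma realizable_mulr s Phi i : realizable s Phi ->
  realizable (i :: s) (fun a => mul (Phi a) (a i)).
Proof.
case=> l ls lE; exists [seq (p.1, Node p.2 (Var i)) | p <- l].
  rewrite all_map; apply/allP => p /(allP ls) /= ps.
  by rewrite cats1 perm_rcons perm_cons.
move=> a; rewrite lE big_map linear_sumlz; apply: eq_bigr => p _ /=.
by rewrite linearZl_LR.
Qed.

Lemma multilinear_realizable n (f : freealg F) :
  multilinear n f -> realizable (iota 0 n) (fun a => eval mul a f).
Proof.
move=> Pf; exists [seq (mcoeff m f, m) | m <- msupp f].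
  by rewrite all_map; apply/allP => m /Pf.
by move=> a; rewrite big_map.
Qed.

Lemma realizable_multilinear n Phi : realizable (iota 0 n) Phi ->
  exists2 f : freealg F, multilinear n f & forall a, eval mul a f = Phi a.
Proof.
case=> l ls lE; exists (\sum_(p <- l) p.1 *: mkmalgU p.2 1); last first.
  move=> a; rewrite lE linear_sum; apply: eq_bigr => p _.
  by rewrite linearZ /= eval_mon scale1r.
have sP := multilinear_subspace F n.
elim: l ls {lE} => [_|p l IH /= /andP[pn /IH Pl]].
  by rewrite big_nil; exact: sP.1.
rewrite big_cons; apply: sP.2 => // m; rewrite -mcoeff_neq0 mcoeffU.
by have [<-|_] := eqVneq p.2 m; rewrite // mulr0n eqxx.
Qed.

Lemma multilinear_comb n k (e : 'I_k -> freealg F) c :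
  (forall i, multilinear n (e i)) -> multilinear n (\sum_i c i *: e i).
Proof.
move=> Pe; have sP := multilinear_subspace F n.
apply: (@subspace_sum F (freealg F) (@multilinear F n) _ _ sP) => i.
exact: (subspaceZ (c i) sP (Pe i)).
Qed.

Lemma eval_comb a k (e : 'I_k -> freealg F) c :
  eval mul a (\sum_i c i *: e i) = \sum_i c i *: eval mul a (e i).
Proof. by rewrite linear_sum; apply: eq_bigr => i _; rewrite linearZ. Qed.

(** Renaming each variable to its position in [s] turns the [Phi i] into evaluations of members of
    [P_n]; independence as functions is independence modulo identities. *)
Lemma codim_ge (I : finType) s (Phi : I -> (nat -> A) -> A) : uniq s ->
  (forall i, realizable s (Phi i)) ->
  (forall c : I -> F, (forall a, \sum_i c i *: Phi i a = 0) ->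
    forall i, c i = 0) ->
  (#|I| <= codim mul (size s))%N.
Proof.
move=> us rPhi free; pose rho j := index j s.
have rho_s : map rho s = iota 0 (size s).
  apply: (@eq_from_nth _ 0%N); first by rewrite size_map size_iota.
  move=> i; rewrite size_map => lt; rewrite (nth_map 0%N) // nth_iota //.
  by rewrite /rho index_uniq.
have /choice[f fP] : forall i, exists f : freealg F,
    multilinear (size s) f /\ forall a, eval mul a f = Phi i (a \o rho).
  move=> i; have := realizable_rename rho (rPhi i); rewrite rho_s.
  by case/realizable_multilinear => f; exists f.
have [e [_ _ se]] := codimP mul (size s).
apply: (free_mod_le (e := fun j => f (enum_val j)) (s := e)
  (multilinear_identities_subspace mul (size s))); last first.
  by move=> j; apply: se; exact: (fP _).1.
move=> c [_ c0] j; rewrite -(enum_valK j).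
apply: (free (c \o enum_rank)) => b.
apply: etrans (c0 (fun i => b (nth 0%N s i))); rewrite eval_comb.
rewrite (reindex _ (onW_bij _ (@enum_val_bij I))) /=; apply: eq_bigr => k _.
rewrite /= enum_valK (fP _).2; congr (_ *: _).
apply: (realizable_local (rPhi _)) => i is_ /=.
by rewrite /rho nth_index.
Qed.

(** Modulo identities, a multilinear polynomial is determined by the coordinates of its values at
    words in the basis vectors; [X] indexes these coordinates. *)
Lemma codim_le n : (codim mul n <= dim A ^ n * dim A)%N.
Proof.
have [e [Pe fe _]] := codimP mul n.
pose X : finType := ({ffun 'I_n -> 'I_(dim A)} * 'I_(dim A))%type.
pose wd (w : {ffun 'I_n -> 'I_(dim A)}) i :=
  if insub i is Some j then ebase (w j) else 0 : A.
pose g i : {ffun X -> F^o} := [ffun x => v2r (eval mul (wd x.1) (e i)) 0 x.2].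
have -> : (dim A ^ n * dim A)%N = #|X|.
  by rewrite card_prod card_ffun !card_ord.
apply: (@free_mod_le _ _ [set 0]%classic _ _ g
  (fun j => [ffun x => (x == enum_val j)%:R])).
- by split=> // a u v -> ->; rewrite scaler0 addr0.
- move=> c c0; apply: fe; split.
    exact: multilinear_comb.
  apply: multilin_vanish.
    apply: (realizable_multilin (iota_uniq 0 n)); apply: multilinear_realizable.
    exact: multilinear_comb.
  move=> a /= ab.
  have /choice[w wE] : forall i : 'I_n, exists k, a i = ebase k.
    by move=> i; apply: ab; rewrite mem_iota /= add0n.
  apply: v2r_inj; rewrite linear0; apply/rowP => k; rewrite mxE.
  have /ffunP/(_ ([ffun i => w i], k)) := c0; rewrite [RHS]ffunE => c0w.
  apply: etrans c0w; rewrite sum_ffunE eval_comb linear_sum summxE.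
  apply: eq_bigr => i _; rewrite !ffunE linearZ mxE /=; congr (_ * v2r _ 0 k).
  apply: (realizable_local (multilinear_realizable (Pe i))) => j.
  rewrite mem_iota /= add0n => jn.
  by rewrite /wd insubT /= ffunE -wE.
- move=> i; exists (fun j => g i (enum_val j)); apply/eqP; rewrite subr_eq0.
  apply/eqP/ffunP => x; rewrite sum_ffunE (bigD1 (enum_rank x)) //= big1.
    by rewrite !ffunE enum_rankK eqxx addr0 /GRing.scale /= mulr1.
  move=> j; rewrite !ffunE => jx; case: eqP => [xE|_]; last exact: mulr0.
  by rewrite xE enum_valK eqxx in jx.
Qed.

(** Right multiplication by a new variable is injective modulo identities. *)
Lemma codim_le_succ n : (forall x, x != 0 -> exists y, mul x y != 0) ->
  (codim mul n <= codim mul n.+1)%N.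
Proof.
move=> ann; have [e [Pe fe _]] := codimP mul n.
have -> : n.+1 = size (n :: iota 0 n) by rewrite /= size_iota.
rewrite -[X in (X <= _)%N]card_ord.
apply: (codim_ge (Phi := fun i a => mul (eval mul a (e i)) (a n))).
- by rewrite /= mem_iota iota_uniq andbT ltnn andbF.
- by move=> i; apply: realizable_mulr; exact: multilinear_realizable.
move=> c c0; apply: fe.
have Pf : multilinear n (\sum_i c i *: e i) by exact: multilinear_comb.
split=> // a; apply/eqP/negPn/negP => /ann[y /eqP]; apply.
rewrite (realizable_local (multilinear_realizable Pf) (b := upd a n y)).
  rewrite -[RHS](c0 (upd a n y)) updE eval_comb linear_sumlz.
  by apply: eq_bigr => i _; rewrite linearZl_LR.
move=> j; rewrite mem_iota add0n /= => jn; rewrite /upd.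
by case: eqP => // jE; rewrite jE ltnn in jn.
Qed.

End Realizable.

(** * An alternating polynomial that is not an identity *)

Section MultiplicationAlgebra.
Variables (F : closedFieldType) (A : vectType F) (mul : {bilinear A -> A -> A}).

Inductive mulop : (A -> A) -> Prop :=
| mulop_id : mulop id
| mulop_l u f : mulop f -> mulop (fun v => mul u (f v))
| mulop_r u f : mulop f -> mulop (fun v => mul (f v) u)
| mulop_lin c f g : mulop f -> mulop g -> mulop (fun v => c *: f v + g v).

Lemma mulop_linear f : mulop f -> linear f.
Proof.
elim=> [c u v|u g _ IH c v w|u g _ IH c v w|d g h _ IHg _ IHh c v w] //.
- by rewrite IH linearDr /= linearZr_LR.
- by rewrite IH linearDl /= linearZl_LR.
- by rewrite IHg IHh !scalerDr !scalerA mulrC addrACA.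
Qed.

Lemma mulop_comp f g : mulop f -> mulop g -> mulop (f \o g).
Proof.
move=> + mg; elim=> [|u h _ IH|u h _ IH|c h k _ IHh _ IHk] //.
- exact: (mulop_l u IH).
- exact: (mulop_r u IH).
- exact: (mulop_lin c IHh IHk).
Qed.

Definition simple_algebra := forall W : set A, subspace W ->
  (forall u v, W v -> W (mul u v) /\ W (mul v u)) ->
  (forall v, W v -> v = 0) \/ forall v, W v.

Hypothesis simpleA : simple_algebra.

(** The orbit of [c] is an ideal containing [c]. *)
Lemma mulop_transitive c : c != 0 -> forall a, exists2 f, mulop f & f c = a.
Proof.
move=> c0; pose W v := exists2 f, mulop f & f c = v.
have [||W0|//] := @simpleA W.
- split=> [|d _ _ [f mf <-] [g mg <-]].
    exists (fun v => -1 *: v + v); first by apply: mulop_lin; exact: mulop_id.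
    by rewrite scaleN1r addNr.
  by exists (fun v => d *: f v + g v); first exact: mulop_lin.
- move=> u _ [f mf <-]; split.
    by exists (fun v => mul u (f v)); first exact: mulop_l.
  by exists (fun v => mul (f v) u); first exact: mulop_r.
by case/eqP: c0; apply: W0; exists id => //; exact: mulop_id.
Qed.

(* If T has minimal rank and T x, T y are independent, pick S with S (T x) = y;
   for an eigenvalue k of T S on the image of T, the operator T S T - k T is
   nonzero of smaller rank. *)
Lemma mulop_rank1 : (exists x : A, x != 0) ->
  exists T (phi : A -> F) c, [/\ mulop T, forall v, T v = phi v *: c,
    scalar phi, c != 0 & exists x, phi x = 1].
Proof.
case=> x1 x10.
pose Q k := `[< exists T,
  [/\ mulop T, exists x, T x != 0 & \rank (lmx T) = k] >].
have Qex : exists k, Q k.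
  by exists (\rank (lmx (@id A))); apply/asboolP; exists id; split;
    [exact: mulop_id | exists x1 |].
case: (ex_minnP Qex) => r /asboolP[T [mT [x Tx0] rT]] minr.
have mL f : mulop f -> exists g : {linear A -> A}, g = f :> (A -> A).
  move=> mf.
  pose g : {linear A -> A} :=
    HB.pack f (GRing.isLinear.Build F A A _ f (mulop_linear mf)).
  by exists g.
have line y : exists k, T y = k *: T x.
  apply: contrapT => /forallNP ny.
  have [S mS Sy] := mulop_transitive Tx0 y.
  have [TL TLE] := mL T mT; have [SL SLE] := mL S mS.
  pose M := lmx T; pose N := lmx S *m lmx T; pose Rb := row_base M.
  have r0 : (0 < \rank M)%N.
    rewrite lt0n mxrank_eq0; apply: contra Tx0 => /eqP M0.
    by rewrite -TLE -(v2rK (TL x)) -mul_lmx TLE -/M M0 mulmx0 linear0.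
  have stab : (Rb *m N <= Rb)%MS.
    by rewrite (eqmxMr _ (eq_row_base M)) !eq_row_base mulmxA submxMl.
  (* On row vectors [N] is [T] after [S]; [K] is its matrix on the image of [T] in the basis
     [Rb]. *)
  pose K := Rb *m N *m pinvmx Rb.
  have KE : K *m Rb = Rb *m N by rewrite mulmxKpV.
  have /closed_rootP[k] : size (char_poly K) != 1%N.
    by rewrite size_char_poly eqSS -lt0n.
  rewrite -eigenvalue_root_char => /eigenvalueP[z zK z0].
  pose T' v := - k *: T v + T (S (T v)).
  have mT' : mulop T'.
    apply: mulop_lin => //.
    exact: (mulop_comp mT (mulop_comp mS mT)).
  have [T'L T'LE] := mL T' mT'.
  have T'E : lmx T' = M *m (N - k%:M).
    apply/row_matrixP => i; rewrite !rowE mulmxA.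
    rewrite -[delta_mx 0 i]r2vK -T'LE mul_lmx -[M]/(lmx T) -TLE mul_lmx.
    rewrite mulmxBr mul_mx_scalar /N mulmxA -TLE -SLE !mul_lmx.
    by rewrite T'LE /T' TLE SLE linearD linearZ /= scaleNr addrC.
  have : Q (\rank (lmx T')).
    apply/asboolP; exists T'; split=> //; exists x.
    rewrite /T' Sy addrC scaleNr subr_eq0; apply/eqP; exact: ny.
  move/minr; rewrite -rT T'E -/M leqNgt => /negP; apply.
  (* The eigenvector lies in the image of [T] and is killed by [N - k], so the rank drops. *)
  rewrite -[X in (_ < X)%N](mxrank_mul_ker M (N - k%:M)) -addn1 leq_add2l.
  rewrite lt0n mxrank_eq0; apply: contra z0 => /eqP cap0.
  have : (z *m Rb <= M :&: kermx (N - k%:M))%MS.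
    rewrite sub_capmx; apply/andP; split.
      by rewrite (submx_trans (submxMl _ _)) // eq_row_base.
    apply/sub_kermxP; rewrite mulmxBr -mulmxA -KE mulmxA zK mul_mx_scalar.
    by rewrite -scalemxAl subrr.
  rewrite cap0 submx0 => /eqP zR.
  apply/eqP/(row_free_inj (row_base_free M)); by rewrite mul0mx.
have /choice[phi phiE] := line.
exists T, phi, (T x); split=> //; last first.
  exists x; apply/eqP; rewrite -subr_eq0; apply: contraTT Tx0 => nz.
  rewrite negbK -(inj_eq (scalerI nz)) scaler0 scalerBl scale1r -phiE.
  by rewrite subrr.
move=> c u v; apply/eqP; rewrite -subr_eq0; apply: contraTT Tx0 => nz.
rewrite negbK -(inj_eq (scalerI nz)) scaler0 scalerBl scalerDl -!phiE.
by rewrite (mulop_linear mT) -scalerA -phiE subrr.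
Qed.

End MultiplicationAlgebra.

Lemma perm_map_enum (T : finType) (s : {perm T}) :
  perm_eq (map s (enum T)) (enum T).
Proof.
apply: uniq_perm => [||x]; first by rewrite map_inj_uniq ?enum_uniq //;
  exact: perm_inj.
  exact: enum_uniq.
rewrite mem_enum; apply/mapP.
by exists ((s^-1)%g x); rewrite ?mem_enum ?permKV.
Qed.

(** * Alternation of polynomials with coefficients in the algebra *)

Section AlternatingPolynomial.
Variables (F : closedFieldType) (A : vectType F) (mul : {bilinear A -> A -> A}).
Local Notation d := (dim A).
Implicit Types (x : 'I_d -> A) (a : nat -> A).

(** Monomials that may contain constants from [A]; [S] lists their variables. The constants are
    later replaced by further variables. *)
Inductive gmon : seq 'I_d -> (('I_d -> A) -> A) -> Prop :=
| gmon_const c : gmon [::] (fun=> c)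
| gmon_l u S f : gmon S f -> gmon S (fun x => mul u (f x))
| gmon_r u S f : gmon S f -> gmon S (fun x => mul (f x) u)
| gmon_var i S f : gmon S f -> gmon (i :: S) (fun x => mul (x i) (f x)).

Inductive gpoly : seq 'I_d -> (('I_d -> A) -> A) -> Prop :=
| gpoly_mon S f : gmon S f -> gpoly S f
| gpoly_lin c S f g : gpoly S f -> gpoly S g ->
    gpoly S (fun x => c *: f x + g x).

Lemma gpoly_eq S f g : f =1 g -> gpoly S f -> gpoly S g.
Proof. by move/funext => ->. Qed.

Lemma gpoly_l u S f : gpoly S f -> gpoly S (fun x => mul u (f x)).
Proof.
elim=> [T g mg|c T g h _ IHg _ IHh]; first by apply: gpoly_mon; exact: gmon_l.
apply: gpoly_eq (gpoly_lin c IHg IHh) => x.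
by rewrite linearDr /= linearZr_LR.
Qed.

Lemma gpoly_r u S f : gpoly S f -> gpoly S (fun x => mul (f x) u).
Proof.
elim=> [T g mg|c T g h _ IHg _ IHh]; first by apply: gpoly_mon; exact: gmon_r.
apply: gpoly_eq (gpoly_lin c IHg IHh) => x.
by rewrite linearDl /= linearZl_LR.
Qed.

Lemma gpoly_var i S f : gpoly S f -> gpoly (i :: S) (fun x => mul (x i) (f x)).
Proof.
elim=> [T g mg|c T g h _ IHg _ IHh]; first by apply: gpoly_mon; exact: gmon_var.
apply: gpoly_eq (gpoly_lin c IHg IHh) => x.
by rewrite linearDr /= linearZr_LR.
Qed.

Lemma gpoly_mulop R S f :
  mulop mul R -> gpoly S f -> gpoly S (fun x => R (f x)).
Proof.
move=> mR gf; elim: mR => [|u g _ IH|u g _ IH|c g h _ IHg _ IHh] //.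
- exact: gpoly_l.
- exact: gpoly_r.
- exact: gpoly_lin.
Qed.

Definition alt_sum (f : ('I_d -> A) -> A) : A :=
  \sum_(s : 'S_d) (-1) ^+ s *: f (fun i => ebase (s i)).

Lemma alt_sum_gmon S f : gpoly S f -> alt_sum f != 0 ->
  exists2 g, gmon S g & alt_sum g != 0.
Proof.
elim=> [T g mg g0|c T g h _ IHg _ IHh gh0]; first by exists g.
have [g0|/IHg //] := eqVneq (alt_sum g) 0.
have [h0|/IHh //] := eqVneq (alt_sum h) 0.
case/eqP: gh0.
transitivity (c *: alt_sum g + alt_sum h); last by rewrite g0 h0 scaler0 addr0.
rewrite scaler_sumr -big_split; apply: eq_bigr => s _ /=.
by rewrite scalerDr !scalerA mulrC.
Qed.

(** Each constant becomes a fresh variable numbered from [d] on, and [b] records the values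
    restoring the constants. *)
Lemma gmon_monomial S f : gmon S f -> exists m n (b : nat -> A),
  perm_eq (leaves m) (map val S ++ iota d n) /\
  forall a x, (forall i, a (val i) = x i) ->
    (forall j, (d <= j < d + n)%N -> a j = b j) -> mon_eval mul a m = f x.
Proof.
have iS n : iota d n.+1 = iota d n ++ [:: (d + n)%N] by rewrite -addn1 iotaD.
have fresh n (b : nat -> A) u : exists b', b' (d + n)%N = u /\
    forall a : nat -> A, (forall j, (d <= j < d + n.+1)%N -> a j = b' j) ->
    a (d + n)%N = u /\ forall j, (d <= j < d + n)%N -> a j = b j.
  exists (upd b (d + n) u); rewrite updE.
  split=> // a ab; split=> [|j /andP[dj jn]].
    by rewrite ab ?updE // leq_addr addnS leqnn.
  rewrite ab ?dj; last by rewrite addnS ltnW.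
  by rewrite /upd; case: eqP => // jE; rewrite jE ltnn in jn.
elim=> [c|u T g _ [m [n [b [mn mE]]]]|u T g _ [m [n [b [mn mE]]]]
        |i T g _ [m [n [b [mn mE]]]]].
- exists (Var d), 1%N, (fun=> c); split=> // a x _ ab /=; apply: ab.
  by rewrite leqnn addn1 ltnSn.
- have [b' [_ b'E]] := fresh n b u.
  exists (Node (Var (d + n)) m), n.+1, b'; split=> [|a x ax /b'E[<- ab]].
    by rewrite iS catA cats1 perm_sym perm_rcons perm_sym /= perm_cons.
  by rewrite /= (mE a x).
- have [b' [_ b'E]] := fresh n b u.
  exists (Node m (Var (d + n))), n.+1, b'; split=> [|a x ax /b'E[<- ab]].
    by rewrite iS catA /= perm_cat2r.
  by rewrite /= (mE a x).
- exists (Node (Var i) m), n, b; split=> [|a x ax ab] /=.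
    by rewrite perm_cons.
  by rewrite (mE a x) // ax.
Qed.

Definition bdet (b : 'I_d -> nat) a : F :=
  \det (\matrix_(i, j) v2r (a (b i)) 0 j).

Lemma bdet_local b a a' :
  (forall i, a (b i) = a' (b i)) -> bdet b a = bdet b a'.
Proof. by move=> aa; congr (\det _); apply/matrixP => i j; rewrite !mxE aa. Qed.

Lemma bdet_multilin (b : 'I_d -> nat) : injective b ->
  multilin (A := A) (V := F^o) (codom b) (bdet b).
Proof.
move=> binj _ /codomP[i ->] a c u v.
rewrite -[X in _ = _ + X]mul1r.
apply: (determinant_multilinear (i0 := i)).
- by apply/rowP => j; rewrite !mxE !updE linearP !mxE mul1r.
- apply/matrixP => k j; rewrite !mxE /upd (inj_eq binj).
  by rewrite eq_sym (negbTE (neq_lift _ _)).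
- apply/matrixP => k j; rewrite !mxE /upd (inj_eq binj).
  by rewrite eq_sym (negbTE (neq_lift _ _)).
Qed.

Definition subst_first a x : nat -> A :=
  fun j => if insub j is Some i then x i else a j.

Lemma subst_first_lt a x (i : 'I_d) : subst_first a x (val i) = x i.
Proof. by rewrite /subst_first valK. Qed.

Lemma subst_first_ge a x j : (d <= j)%N -> subst_first a x j = a j.
Proof. by move=> dj; rewrite /subst_first insubF // ltnNge dj. Qed.

Lemma subst_first_twice a x y :
  subst_first (subst_first a x) y = subst_first a y.
Proof.
apply/funext => j; have [jd|dj] := ltnP j d; last by rewrite !subst_first_ge.
by rewrite -[j]/(val (Ordinal jd)) !subst_first_lt.
Qed.

Hypothesis F0 : [pchar F] =i pred0.

(** For a permutation [w] the sum is reindexed; if [w] identifies two indices, their transposition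
    changes the sign of the left side, which then vanishes in characteristic zero. *)
Lemma alternating_sum_basis (h : ('I_d -> 'I_d) -> A) (w : 'I_d -> 'I_d) :
  \sum_(s : 'S_d) (-1) ^+ s *: h (w \o s) =
  \det (\matrix_(i, j) (w i == j)%:R) *: \sum_(s : 'S_d) (-1) ^+ s *: h s.
Proof.
have [/injectiveP winj|/injectivePn[i1 [i2 ni wi]]] := boolP (injectiveb w).
  pose t := perm winj.
  have -> : \matrix_(i, j) (w i == j)%:R = perm_mx t :> 'M[F]_d.
    by apply/matrixP => i j; rewrite !mxE permE.
  rewrite det_perm scaler_sumr (reindex_inj (mulIg t^-1%g)) /=.
  apply: eq_bigr => s _; rewrite scalerA odd_permM odd_permV signr_addb mulrC.
  congr (_ *: h _); apply/funext => i /=.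
  by rewrite -(permE winj) -permM mulgKV.
have -> : \det (\matrix_(i, j) (w i == j)%:R : 'M[F]_d) = 0.
  by apply: (determinant_alternate ni) => j; rewrite !mxE wi.
rewrite scale0r; set S := \sum_s _.
have SN : S = - S.
  rewrite {1}/S (reindex_inj (mulIg (tperm i1 i2))) -sumrN.
  apply: eq_bigr => s _ /=; rewrite odd_permM odd_tperm ni addbT signrN scaleNr.
  congr (- (_ *: h _)); apply/funext => i /=; rewrite permM.
  by case: tpermP => // ->.
apply/eqP; have : S *+ 2 == 0 by rewrite mulr2n {1}SN addNr.
by rewrite -scaler_nat scaler_eq0; move/pcharf0P: F0 => ->.
Qed.

Hypothesis simpleA : simple_algebra mul.
Hypothesis annA : forall u, u != 0 -> exists v, mul u v != 0.
Hypothesis neq0A : exists u : A, u != 0.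

(** With a rank-one [T] and its functional [phi], the functionals [u |-> phi (R (mul u v))] span the
    dual of [A]; alternating a product of [d] independent ones gives a nonzero determinant. *)
Lemma gpoly_alternating : exists2 f, gpoly (enum 'I_d) f & alt_sum f != 0.
Proof.
have [T [phi [c [mT TE phi_lin c0 [y0 phi1]]]]] := mulop_rank1 simpleA neq0A.
pose P (r : 'rV[F]_d) := exists2 R, mulop mul R &
  exists v, r = \row_j phi (R (mul (ebase j) v)).
have phi_sum (k : 'I_d -> F) R v : mulop mul R ->
    \sum_j k j * phi (R (mul (ebase j) v)) =
    phi (R (mul (\sum_j k j *: ebase j) v)).
  move=> mR.
  pose L u : F^o := phi (R (mul u v)).
  have Llin : linear L.
    move=> e u w; rewrite /L linearDl /= linearZl_LR.
    by rewrite (mulop_linear mR) phi_lin.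
  pose LL : {linear A -> F^o} :=
    HB.pack L (GRing.isLinear.Build F A F^o _ L Llin).
  rewrite -[RHS]/(LL _) linear_sum; apply: eq_bigr => j _.
  by rewrite linearZ.
have [k [M [Mfree PM maxM]]] := row_free_max P.
(* A nonzero [w] killed by all these functionals is impossible: some [mul w v] is nonzero, and some
   [R] sends it to [y0], where [phi] is 1. *)
have coker0 : cokermx M = 0.
  apply/eqP/negPn/negP => /matrix0Pn[i [l nz]].
  pose w := \sum_j cokermx M j l *: ebase j : A.
  have w0 : w != 0.
    apply: contra nz => /eqP/(congr1 (fun u => v2r u 0 i)).
    by rewrite (v2r_comb (cokermx M ^~ l)) linear0 [RHS]mxE => ->.
  have [v wv] := annA w0; have [R mR Rwv] := mulop_transitive simpleA wv y0.
  have /maxM : P (\row_j phi (R (mul (ebase j) v))) by exists R => //; exists v.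
  rewrite submxE => /eqP/rowP/(_ l); rewrite !mxE.
  under eq_bigr do rewrite mxE mulrC.
  by rewrite phi_sum // -/w Rwv phi1 => /eqP; rewrite oner_eq0.
have kd : k = d.
  have := mxrank_coker M; rewrite coker0 mxrank0 (eqP Mfree) => /esym/eqP.
  rewrite subn_eq0 => dk; apply/eqP; rewrite eqn_leq dk andbT.
  by rewrite -(eqP Mfree) rank_leq_col.
move: M Mfree PM {maxM coker0}; rewrite kd => M Mfree PM.
have /choice[R /choice[v RvE]] : forall i, exists R v, mulop mul R /\
    forall j, M i j = phi (R (mul (ebase j) v)).
  move=> i; have [R mR [v vE]] := PM i; exists R, v; split=> // j.
  by have /rowP/(_ j) := vE; rewrite !mxE.
pose psi i u := phi (R i (mul u (v i))).
(* Each link sends [c] to [v i] by [S], multiplies by [x i], and returns through [R i] and [T] to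
   [psi i (x i) *: c]. *)
have chain (l : seq 'I_d) : gpoly l (fun x => \prod_(i <- l) psi i (x i) *: c).
  elim: l => [|i l IH].
    apply: gpoly_eq (gpoly_mon (gmon_const c)) => x.
    by rewrite big_nil scale1r.
  have [S mS Sc] := mulop_transitive simpleA c0 (v i); have [mR _] := RvE i.
  apply: gpoly_eq (gpoly_mulop mT (gpoly_mulop mR (gpoly_var i
    (gpoly_mulop mS IH)))) => x.
  have SZ e u : S (e *: u) = e *: S u.
    exact: (GRing.scalable_linear (mulop_linear mS)).
  have RZ e u : R i (e *: u) = e *: R i u.
    exact: (GRing.scalable_linear (mulop_linear mR)).
  have phiZ e u : phi (e *: u) = e * phi u.
    exact: (GRing.scalable_linear phi_lin).
  by rewrite SZ Sc linearZr_LR /= RZ TE phiZ big_cons mulrC.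
exists (fun x => \prod_(i <- enum 'I_d) psi i (x i) *: c); first exact: chain.
have -> : alt_sum (fun x => \prod_(i <- enum 'I_d) psi i (x i) *: c) =
    \det M *: c.
  rewrite /alt_sum scaler_suml; apply: eq_bigr => s _; rewrite scalerA big_enum.
  congr (_ * _ *: _); apply: eq_bigr => i _.
  by rewrite (RvE i).2.
rewrite scaler_eq0 negb_or c0 andbT -unitfE -[_ \is a _]/(M \in unitmx).
by rewrite -row_free_unit.
Qed.

Definition fblock : 'I_d -> nat := val.

(** An alternating multilinear function of [d] vectors is the determinant times its value on the
    basis; [g] is that value as a function of the remaining variables. *)
Lemma alternating_polynomial : exists (n : nat) (g : (nat -> A) -> A),
  [/\ realizable mul (iota 0 (d + n)) (fun a => bdet fblock a *: g a),
      forall a i v, (i < d)%N -> g (upd a i v) = g a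
    & exists a, bdet fblock a *: g a != 0].
Proof.
have [f0 gf0 f0alt] := gpoly_alternating.
have [f mf falt] := alt_sum_gmon gf0 f0alt.
have [m [n [b [mn mE]]]] := gmon_monomial mf.
have {}mn : perm_eq (leaves m) (iota 0 (d + n)).
  by rewrite iotaD add0n -val_enum_ord.
pose rho (s : 'S_d) j := if insub j is Some i then val (s i) else j.
have rho_lt s (i : 'I_d) : rho s (val i) = val (s i) by rewrite /rho valK.
have rho_ge s j : (d <= j)%N -> rho s j = j.
  by move=> dj; rewrite /rho insubF // ltnNge dj.
pose Phi a := \sum_(s : 'S_d) (-1) ^+ s *: mon_eval mul (a \o rho s) m.
have rPhi : realizable mul (iota 0 (d + n)) Phi.
  apply: realizable_sum => s; apply: realizableZ.
  apply: (realizable_perm (s := map (rho s) (leaves m))); last first.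
    apply: (realizable_rename (Phi := fun a => mon_eval mul a m)).
    exact: realizable_mon.
  apply: (perm_trans (perm_map (rho s) mn)).
  rewrite iotaD map_cat add0n -val_enum_ord.
  rewrite [X in _ ++ X](_ : _ = iota d n); last first.
    rewrite -[RHS]map_id; apply/eq_in_map => j.
    by rewrite mem_iota => /andP[/rho_ge].
  rewrite perm_cat2r -!map_comp.
  rewrite (eq_map (g := val \o s)) => [|i]; last exact: rho_lt.
  rewrite map_comp; apply: perm_map; rewrite -!enumT; exact: perm_map_enum.
pose g a := Phi (subst_first a (@ebase F A)).
have gE a i v : (i < d)%N -> g (upd a i v) = g a.
  move=> id; congr Phi; apply/funext => j; rewrite /subst_first /upd.
  by case: insubP => //; case: eqP => // ->; rewrite id.
exists n, g; split=> //; last first.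
  exists (subst_first b (@ebase F A)).
  have -> : bdet fblock (subst_first b (@ebase F A)) = 1.
    rewrite -(det1 F d); congr (\det _); apply/matrixP => i j.
    by rewrite !mxE subst_first_lt v2r_ebase.
  rewrite scale1r; apply: contra falt => /eqP <-; apply/eqP.
  have -> : g (subst_first b (@ebase F A)) = g b.
    by rewrite /g subst_first_twice.
  apply: eq_bigr => s _; congr (_ *: _); apply: esym; apply: mE.
    by move=> i; rewrite /= rho_lt subst_first_lt.
  by move=> j /andP[dj _]; rewrite /= rho_ge // subst_first_ge.
suff PhiE a : Phi a = bdet fblock a *: g a by exact: realizable_eq rPhi.
apply/eqP; rewrite -subr_eq0; apply/eqP; move: a.
apply: (@multilin_vanish F A A (iota 0 d)).
  move=> i; rewrite mem_iota add0n => /= id a c u v.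
  have -> : i = fblock (Ordinal id) by [].
  rewrite (bdet_multilin val_inj) ?codom_f //.
  rewrite (realizable_multilin (iota_uniq 0 (d + n)) rPhi); last first.
    by rewrite mem_iota /= add0n ltn_addr.
  rewrite !gE // !scalerBr !scalerDl !scalerA opprD addrACA.
  by [].
move=> a /= ab; have /choice[w wE] : forall i : 'I_d, exists k, a i = ebase k.
  by move=> i; apply: ab; rewrite mem_iota /= add0n.
pose h (w : 'I_d -> 'I_d) := mon_eval mul (subst_first a (@ebase F A \o w)) m.
have hE (w1 : 'I_d -> 'I_d) s a1 :
    (forall i : 'I_d, a1 (val i) = ebase (w1 i)) ->
    (forall j, (d <= j)%N -> a1 j = a j) ->
    mon_eval mul (a1 \o rho s) m = h (w1 \o s).
  move=> a1w a1a; congr (mon_eval mul _ m); apply/funext => j /=.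
  have [jd|dj] := ltnP j d; last by rewrite rho_ge // subst_first_ge // a1a.
  by rewrite -[j]/(val (Ordinal jd)) rho_lt a1w subst_first_lt.
have -> : Phi a = \sum_(s : 'S_d) (-1) ^+ s *: h (w \o s).
  by apply: eq_bigr => s _; rewrite (hE w).
have -> : g a = \sum_(s : 'S_d) (-1) ^+ s *: h s.
  apply: eq_bigr => s _; rewrite (hE id) // => [i|j].
    exact: subst_first_lt.
  exact: subst_first_ge.
rewrite alternating_sum_basis; apply/eqP; rewrite subr_eq0; apply/eqP.
congr (\det _ *: _); apply/matrixP => i j.
by rewrite !mxE wE v2r_ebase.
Qed.

End AlternatingPolynomial.

(** * Razmyslov's trace identity *)

(** Expanding the [i]-th determinant along row [i] gives the [i]-th diagonal entry of
    [X *m T *m \adj X]. *)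
Lemma sum_det_row_mul (R : comNzRingType) n (X T : 'M[R]_n) :
  \sum_i \det (\matrix_(k, j) if k == i then (X *m T) k j else X k j) =
  \tr T * \det X.
Proof.
transitivity (\tr (X *m T *m \adj X)).
  apply: eq_bigr => i _; rewrite (expand_det_row _ i) mxE.
  apply: eq_bigr => j _; rewrite !mxE eqxx; congr (_ * (_ * \det _)).
  by apply/matrixP => k l; rewrite !mxE eq_sym (negbTE (neq_lift _ _)).
rewrite -mulmxA mxtrace_mulC -mulmxA mul_adj_mx mul_mx_scalar mxtraceZ.
exact: mulrC.
Qed.

Section Razmyslov.
Variables (F : closedFieldType) (A : vectType F) (mul : {bilinear A -> A -> A}).
Local Notation d := (dim A).
Local Notation bdet := (@bdet F A).
Implicit Types (a : nat -> A) (s : seq nat) (g : (nat -> A) -> A).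

Definition trace_form u v := ltrace (mul u \o mul v).

Lemma sum_bdet_upd (b : 'I_d -> nat) (T : {linear A -> A}) a : injective b ->
  \sum_i bdet b (upd a (b i) (T (a (b i)))) = ltrace T * bdet b a.
Proof.
move=> binj; rewrite ltraceE -sum_det_row_mul; apply: eq_bigr => i _.
congr (\det _); apply/matrixP => k j; rewrite !mxE /upd (inj_eq binj).
case: eqP => // ->; rewrite -mul_lmx mxE; apply: eq_bigr => l _.
by rewrite !mxE.
Qed.

Lemma perm_leaves_subst s i m : uniq s -> i \in s ->
  perm_eq (flatten [seq leaves (if j == i then m else Var j) | j <- s])
    (leaves m ++ rem i s).
Proof.
move=> us is_; apply: (@perm_trans _
    (flatten [seq leaves (if j == i then m else Var j) | j <- i :: rem i s])).
  by apply: perm_flatten; apply: perm_map; exact: perm_to_rem.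
rewrite /= eqxx perm_cat2l rem_filter //.
elim: s {us is_} => //= j s IH; case: eqP => //= /eqP /negbTE ->.
by rewrite /= perm_cons.
Qed.

Section Insertion.
Variables (b0 : 'I_d -> nat).
Hypothesis b0_inj : injective b0.

Lemma realizable_trace_form s g p q : uniq s -> (forall i, b0 i \in s) ->
  (forall a i v, g (upd a (b0 i) v) = g a) ->
  realizable mul s (fun a => bdet b0 a *: g a) ->
  realizable mul (p :: q :: s)
    (fun a => bdet b0 a *: (trace_form (a p) (a q) *: g a)).
Proof.
move=> us b0s gb rg.
pose m i := Node (Var p) (Node (Var q) (Var (b0 i))).
pose sig i j := if j == b0 i then m i else Var j.
have rI i : realizable mul (p :: q :: s) (fun a =>
    bdet b0 (upd a (b0 i) ((mul (a p) \o mul (a q)) (a (b0 i)))) *: g a).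
  apply: (realizable_perm (s := flatten [seq leaves (sig i j) | j <- s])).
    apply: (perm_trans (perm_leaves_subst (m i) us (b0s i))).
    by rewrite /= !perm_cons perm_sym; exact: perm_to_rem.
  apply: realizable_eq (realizable_subst (sig i) rg) => a /=.
  have -> : (fun j => mon_eval mul a (sig i j)) =
      upd a (b0 i) (mul (a p) (mul (a q) (a (b0 i)))).
    by apply/funext => j; rewrite /sig /upd; case: eqP => // ->.
  by rewrite gb.
apply: realizable_eq (realizable_sum rI) => a.
by rewrite -scaler_suml sum_bdet_upd // scalerA mulrC.
Qed.

Lemma realizable_trace_forms s g (ps : seq (nat * nat)) :
  uniq (flatten [seq [:: p.1; p.2] | p <- ps] ++ s) -> (forall i, b0 i \in s) ->
  (forall a i v, g (upd a (b0 i) v) = g a) ->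
  realizable mul s (fun a => bdet b0 a *: g a) ->
  realizable mul (flatten [seq [:: p.1; p.2] | p <- ps] ++ s)
    (fun a => bdet b0 a *: (\prod_(p <- ps) trace_form (a p.1) (a p.2) *: g a)).
Proof.
move=> + b0s gb rg.
elim: ps => [_|[p q] ps IH /= /and3P[]].
  by apply: realizable_eq rg => a; rewrite big_nil scale1r.
rewrite inE negb_or => /andP[_ ps_p] qs_q us.
apply: realizable_eq (realizable_trace_form p q us _ _ (IH us)) => [a|i|a i v].
- by rewrite big_cons scalerA.
- by rewrite mem_cat b0s orbT.
rewrite gb big_seq [in RHS]big_seq; congr (_ *: _).
apply: eq_bigr => r rps.
have out j : j \in [:: r.1; r.2] -> upd a (b0 i) v j = a j.
  move=> jr; rewrite /upd; case: eqP => // jE.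
  have : b0 i \notin flatten [seq [:: x.1; x.2] | x <- ps].
    move: us; rewrite cat_uniq => /and3P[_ /hasPn us _].
    exact: us.
  by case/negP; rewrite -jE; apply/flatten_mapP; exists r.
by rewrite !out ?inE ?eqxx ?orbT.
Qed.

Hypothesis tau_nondegenerate :
  forall u, u != 0 -> exists v, trace_form u v != 0.

Definition gram : 'M[F]_d := \matrix_(i, j) trace_form (ebase i) (ebase j).

Lemma trace_form_gram u v :
  trace_form u v = (v2r u *m gram *m (v2r v)^T) 0 0.
Proof.
have linr x : scalar (trace_form x).
  move=> c y z; rewrite /trace_form -ltraceZ -ltraceD; apply: eq_ltrace => w /=.
  by rewrite linearDl /= linearZl_LR linearP.
have linl y : scalar (trace_form^~ y).
  move=> c x z; rewrite /trace_form -ltraceZ -ltraceD; apply: eq_ltrace => w /=.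
  by rewrite linearDl /= linearZl_LR.
pose Lr x : {linear A -> F^o} :=
  HB.pack (trace_form x)
    (GRing.isLinear.Build F A F^o _ (trace_form x) (linr x)).
pose Ll y : {linear A -> F^o} := HB.pack (trace_form^~ y)
  (GRing.isLinear.Build F A F^o _ (trace_form^~ y) (linl y)).
transitivity (\sum_j (\sum_i v2r u 0 i * gram i j) * v2r v 0 j); last first.
  by rewrite mxE; apply: eq_bigr => j _; rewrite !mxE.
rewrite -[LHS]/(Lr u v) [in LHS](ebase_decomp v) linear_sum.
apply: eq_bigr => j _; rewrite linearZ.
apply: etrans (mulrC _ _); congr (_ * _).
rewrite -[LHS]/(Ll (ebase j) u) [in LHS](ebase_decomp u) linear_sum.
by apply: eq_bigr => i _; rewrite linearZ mxE.
Qed.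

Lemma det_gram : \det gram != 0.
Proof.
rewrite -unitfE -[_ \is a _]/(gram \in unitmx) -row_free_unit.
rewrite -kermx_eq0; apply/negPn/negP => /rowV0Pn[u /sub_kermxP ug u0].
have [|v] := tau_nondegenerate (u := r2v u).
  by apply: contra u0 => /eqP ru; rewrite -[u]r2vK ru linear0.
by rewrite trace_form_gram r2vK ug mul0mx mxE eqxx.
Qed.

(* Alternating \prod_i trace_form (x i) (y i) in the y i gives the determinant
   of the matrix of the trace_form (x i) (y j). *)
Lemma realizable_block_pair s g (P Q : 'I_d -> nat) :
  uniq (codom P ++ codom Q ++ s) -> (forall i, b0 i \in s) ->
  (forall a i v, g (upd a (b0 i) v) = g a) ->
  realizable mul s (fun a => bdet b0 a *: g a) ->
  realizable mul (codom P ++ codom Q ++ s)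
    (fun a => bdet b0 a *: (bdet P a * bdet Q a *: g a)).
Proof.
move=> us b0s gb rg.
pose ps (t : 'S_d) := [seq (P i, Q (t i)) | i <- enum 'I_d].
have perm_ps t : perm_eq (flatten [seq [:: p.1; p.2] | p <- ps t] ++ s)
    (codom P ++ codom Q ++ s).
  rewrite catA perm_cat2r.
  have : perm_eq (codom P ++ [seq Q (t i) | i <- enum 'I_d])
      (codom P ++ codom Q).
    rewrite perm_cat2l codomE (map_comp Q t); apply: perm_map.
    exact: perm_map_enum.
  apply: perm_trans; rewrite codomE /ps.
  elim: (enum 'I_d) => //= i r IH; rewrite perm_cons perm_sym.
  by rewrite -[_ :: map _ r]cat1s perm_catCA /= perm_cons perm_sym.
have rt (t : 'S_d) : realizable mul (codom P ++ codom Q ++ s)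
    (fun a => bdet b0 a *: (\prod_i trace_form (a (P i)) (a (Q (t i))) *: g a)).
  apply: (realizable_perm (perm_ps t)).
  have := @realizable_trace_forms s g (ps t).
  rewrite (perm_uniq (perm_ps t)) => /(_ us b0s gb rg).
  by apply: realizable_eq => a; rewrite big_map big_enum.
have rsum := realizable_sum (fun t : 'S_d => realizableZ ((-1) ^+ t) (rt t)).
apply: realizable_eq (realizableZ (\det gram)^-1 rsum) => a.
transitivity ((\det gram)^-1 *: (bdet b0 a *: (\det (\matrix_(i, j)
    trace_form (a (P i)) (a (Q j))) *: g a))).
  have -> : \det (\matrix_(i, j) trace_form (a (P i)) (a (Q j))) =
      \sum_(t : 'S_d) (-1) ^+ t * \prod_i trace_form (a (P i)) (a (Q (t i))).
    apply: eq_bigr => t _; congr (_ * _).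
    by apply: eq_bigr => i _; rewrite mxE.
  congr (_ *: _); rewrite [_ *: g a]scaler_suml scaler_sumr.
  by apply: eq_bigr => t _; rewrite !scalerA mulrCA mulrA.
(* The matrix factors through the Gram matrix, whose determinant was divided out in advance. *)
have -> : \matrix_(i, j) trace_form (a (P i)) (a (Q j)) =
    (\matrix_(i, j) v2r (a (P i)) 0 j) *m gram *m
    (\matrix_(i, j) v2r (a (Q i)) 0 j)^T.
  apply/matrixP => i j; rewrite mxE trace_form_gram !mxE.
  apply: eq_bigr => k _; rewrite !mxE; congr (_ * _).
  by apply: eq_bigr => l _; rewrite !mxE.
rewrite !det_mulmx det_tr !scalerA -/(bdet P a) -/(bdet Q a).
by congr (_ *: _); field; exact: det_gram.
Qed.

(** Blocks are adjoined two at a time, whence the parity condition. *)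
Lemma realizable_blocks s g (bl : seq ('I_d -> nat)) :
  ~~ odd (size bl) -> uniq (flatten [seq codom b | b <- bl] ++ s) ->
  (forall i, b0 i \in s) -> (forall a i v, g (upd a (b0 i) v) = g a) ->
  realizable mul s (fun a => bdet b0 a *: g a) ->
  realizable mul (flatten [seq codom b | b <- bl] ++ s)
    (fun a => bdet b0 a *: (\prod_(b <- bl) bdet b a *: g a)).
Proof.
move=> + + b0s gb rg.
have [n] := ubnP (size bl); elim: n bl => // n IH [|P [|Q bl]] //=.
  by move=> _ _ _; apply: realizable_eq rg => a; rewrite big_nil scale1r.
rewrite negbK => ltn ebl us.
have usbl : uniq (flatten [seq codom b | b <- bl] ++ s).
  by move: us; rewrite -!catA catA cat_uniq => /and3P[].
rewrite -!catA in us *.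
have := realizable_block_pair us _ _ (IH bl _ ebl usbl).
have b0s' i : b0 i \in flatten [seq codom b | b <- bl] ++ s.
  by rewrite mem_cat b0s orbT.
move/(_ b0s' _ (ltnW ltn)) => H.
apply: realizable_eq (H _) => [a|a i v].
  by rewrite !big_cons !scalerA !mulrA.
rewrite gb big_seq [in RHS]big_seq; congr (_ *: _).
apply: eq_bigr => b bbl; apply: bdet_local => j; rewrite /upd.
case: eqP => // jE.
have : b0 i \notin flatten [seq codom b | b <- bl].
  move: usbl; rewrite cat_uniq => /and3P[_ /hasPn usbl _].
  exact: usbl.
by case/negP; rewrite -jE; apply/flatten_mapP; exists b => //; exact: codom_f.
Qed.

End Insertion.
End Razmyslov.

(** * Balanced words and the growth of the codimensions *)

Section BalancedWords.
Variables d N : nat.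
Local Notation pos := ('I_d * 'I_N)%type.

Definition balanced : {set {ffun pos -> 'I_d}} :=
  [set w : {ffun pos -> 'I_d} | [forall i, #|[set p | w p == i]| == N]].

Lemma balancedP (w : {ffun pos -> 'I_d}) :
  reflect (forall i, #|[set p | w p == i]| = N) (w \in balanced).
Proof. by rewrite inE; exact: 'forall_eqP. Qed.

(* The default value (i, r) is not used when w is balanced. *)
Definition occ (w : {ffun pos -> 'I_d}) (i : 'I_d) (r : 'I_N) : pos :=
  nth (i, r) (enum [set p | w p == i]) r.

Section Occurrences.
Variable w : {ffun pos -> 'I_d}.
Hypothesis bw : w \in balanced.

Let size_occ i : size (enum [set p | w p == i]) = N.
Proof. by rewrite -cardE; exact: (balancedP w bw). Qed.

Lemma occK i r : w (occ w i r) = i.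
Proof.
have : occ w i r \in enum [set p | w p == i] by rewrite mem_nth ?size_occ.
by rewrite mem_enum inE => /eqP.
Qed.

Lemma occ_inj i r r' : occ w i r = occ w i r' -> r = r'.
Proof.
rewrite /occ (set_nth_default (i, r)) ?size_occ // => /eqP.
by rewrite nth_uniq ?size_occ ?enum_uniq // => /eqP/val_inj.
Qed.

Lemma occ_surj p : exists r, occ w (w p) r = p.
Proof.
have pw : p \in enum [set p' | w p' == w p] by rewrite mem_enum inE.
have lt : (index p (enum [set p' | w p' == w p]) < N)%N.
  by move: pw; rewrite -index_mem size_occ.
by exists (Ordinal lt); rewrite /occ /= nth_index.
Qed.

(** The common letter sum lets a pointwise inequality between balanced words force equality. *)
Lemma sum_balanced : (\sum_p w p = \sum_(i < d) i * N)%N.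
Proof.
rewrite (partition_big w predT) //=; apply: eq_bigr => i _.
under eq_bigr => p /eqP -> do over.
rewrite sum_nat_const mulnC; congr (_ * _)%N.
by apply: etrans (balancedP w bw i); apply: eq_card => p; rewrite !inE.
Qed.

End Occurrences.
End BalancedWords.

Lemma balanced_fst d N : [ffun p : 'I_d * 'I_N => p.1] \in balanced d N.
Proof.
apply/balancedP => i; rewrite -[RHS]card_ord.
rewrite -(card_imset predT (f := fun r => (i, r))) => [|r r' []//].
apply: eq_card => -[j r]; rewrite !inE ffunE /=; apply/eqP/imsetP.
  by move=> ->; exists r.
by case=> r' _ [].
Qed.

(* Some content c occurs for at least d^N / (N+1)^d of the words of length N;
   the concatenation of d such words, the j-th one with its letters shifted
   cyclically by j, is balanced. *)
Lemma card_balanced d N : (0 < d)%N ->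
  (d ^ (d * N) <= #|balanced d N| * N.+1 ^ (d * d))%N.
Proof.
case: d => // d _; pose D := d.+1.
pose content (x : {ffun 'I_N -> 'I_D}) : {ffun 'I_D -> 'I_N.+1} :=
  [ffun i => inord #|[set p | x p == i]|].
have contentE x i : content x i = #|[set p | x p == i]| :> nat.
  by rewrite ffunE inordK // ltnS (leq_trans (max_card _)) ?card_ord.
have content_sum x : (\sum_i content x i = N)%N.
  rewrite -[RHS]card_ord -sum1_card (partition_big x predT) //=.
  apply: eq_bigr => i _; rewrite contentE -sum1_card.
  by apply: eq_bigl => p; rewrite inE.
pose fiber c := [set x | content x == c].
pose c0 : {ffun 'I_D -> 'I_N.+1} := [ffun=> ord0].
pose c := [arg max_(c > c0) #|fiber c|].
have maxc c' : (#|fiber c'| <= #|fiber c|)%N.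
  by rewrite /c; case: arg_maxnP => // k _; apply.
have cardc : (D ^ N <= #|fiber c| * N.+1 ^ D)%N.
  have -> : (D ^ N = \sum_c' #|fiber c'|)%N.
    have -> : (D ^ N = #|{ffun 'I_N -> 'I_D}|)%N by rewrite card_ffun !card_ord.
    rewrite -sum1_card (partition_big content predT) //=; apply: eq_bigr => k _.
    by rewrite -sum1_card; apply: eq_bigl => x; rewrite inE.
  apply: (@leq_trans (\sum_(c' : {ffun 'I_D -> 'I_N.+1}) #|fiber c|)).
    by apply: leq_sum => c' _; exact: maxc.
  by rewrite sum_nat_const card_ffun !card_ord mulnC.
(* Addition is modulo [D]; all [D] pieces have content [c], so every letter occurs [N] times in
   total. *)
pose word (u : {ffun 'I_D -> {x | x \in fiber c}}) :
    {ffun 'I_D * 'I_N -> 'I_D} :=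
  [ffun p => val (u p.1) p.2 + p.1].
have word_inj : injective word.
  move=> u v uv; apply/ffunP => j; apply/val_inj/ffunP => p.
  by have /ffunP/(_ (j, p)) := uv; rewrite !ffunE => /addIr.
have word_balanced u : word u \in balanced D N.
  apply/balancedP => i; rewrite -[RHS](content_sum (val (u 0))).
  rewrite -sum1_card (partition_big fst predT) //=.
  rewrite (reindex (fun j => i - j)) /=; last first.
    by exists (fun j => i - j) => j _; rewrite subKr.
  apply: eq_bigr => j _.
  have -> : content (val (u 0)) j = content (val (u (i - j))) j.
    have := valP (u 0); have := valP (u (i - j)).
    by rewrite !inE => /eqP -> /eqP ->.
  rewrite contentE -sum1_card.
  rewrite (reindex (fun p => (i - j, p))) /=; last first.
    by exists snd => [p _|[k p]] //=; rewrite inE => /andP[_ /eqP /= ->].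
  apply: eq_bigl => p; rewrite !inE ffunE eqxx andbT /=.
  by rewrite [LHS]eq_sym -subr_eq subKr eq_sym.
have : (#|fiber c| ^ D <= #|balanced D N|)%N.
  have <- : (#|{ffun 'I_D -> {x | x \in fiber c}}| = #|fiber c| ^ D)%N.
    by rewrite card_ffun card_ord card_sig.
  rewrite -(card_imset predT word_inj); apply: subset_leq_card.
  by apply/fintype.subsetP => _ /imsetP[u _ ->].
rewrite -(leq_pmul2r (expn_gt0 N.+1 (D * D))) => /(leq_trans _); apply.
by rewrite mulnC expnM [(N.+1 ^ _)%N]expnM -expnMn leq_exp2r.
Qed.

(** * The partition of the variables attached to a sequence of words *)

Section Blocks.
Variables d base N t : nat.
Local Notation pos := ('I_d * 'I_N)%type.
Local Notation word := {ffun pos -> 'I_d}.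
Local Notation spos := ('I_t * pos)%type.

Definition pvar (x : spos) : nat := base + enum_rank x.

Lemma pvar_inj : injective pvar.
Proof. by move=> x y /addnI/val_inj/enum_rank_inj. Qed.

Lemma shift_subproof (q : 'I_t) (i : nat) : ((q + i) %% t < t)%N.
Proof. by rewrite ltn_pmod // (leq_ltn_trans (leq0n q)). Qed.
Definition shift q i : 'I_t := Ordinal (shift_subproof q i).

Lemma shift_inj i : injective (shift^~ i).
Proof.
move=> q q' /(congr1 val) /= /eqP; rewrite eqn_modDr !modn_small // => /eqP.
exact: val_inj.
Qed.

Definition wblock (w : 'I_t -> word) (x : 'I_t * 'I_N) (i : 'I_d) : nat :=
  pvar (shift x.1 i, occ (w (shift x.1 i)) i x.2).

Definition wblocks w : seq ('I_d -> nat) :=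
  [seq wblock w x | x <- enum {: 'I_t * 'I_N}].

(** A position carries its letter [i], which determines the starting segment and the occurrence
    number; so the blocks are disjoint, and by counting they exhaust the positions. *)
Lemma wblocks_perm w : (forall q, w q \in balanced d N) ->
  perm_eq (flatten [seq codom b | b <- wblocks w])
    [seq pvar x | x <- enum {: spos}].
Proof.
move=> bw; rewrite /wblocks -map_comp.
rewrite (eq_map (g := fun x => [seq wblock w x i | i <- enum 'I_d]));
  last first.
  by move=> x; rewrite /= codomE.
set s1 := flatten _; have us1 : uniq s1.
  apply: allpairs_uniq; rewrite ?enum_uniq // => -[[q r] i] [[q' r'] i'] _ _ /=.
  move/pvar_inj => E; have shE := congr1 fst E; have oE := congr1 snd E.
  rewrite /= in shE oE; rewrite -shE in oE.
  have ii' : i = i' by rewrite -(occK (bw (shift q i)) i r) oE occK.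
  rewrite -ii' in shE oE *.
  by rewrite (shift_inj shE) (occ_inj (bw _) oE).
have s1_size : size s1 = size [seq pvar x | x <- enum {: spos}].
  by rewrite size_allpairs size_map -!cardE !card_prod !card_ord mulnAC mulnA.
apply: uniq_perm => //; first by rewrite (map_inj_uniq pvar_inj) enum_uniq.
apply: (uniq_min_size us1 _ _).2; last by rewrite s1_size.
move=> _ /allpairsP[[x i] [_ _ ->]].
by apply: map_f; rewrite mem_enum.
Qed.

End Blocks.

(** * Independence of the products of determinants *)

Section Growth.
Variables (F : closedFieldType) (A : vectType F) (mul : {bilinear A -> A -> A}).
Local Notation d := (dim A).
Local Notation bdet := (@bdet F A).
Implicit Types (a : nat -> A).

Section WordPoints.
Variables base N t : nat.
Local Notation pos := ('I_d * 'I_N)%type.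
Local Notation word := {ffun pos -> 'I_d}.
Local Notation spos := ('I_t * pos)%type.
Variable a0 : nat -> A.

Definition word_point (w : 'I_t -> word) : nat -> A := fun j =>
  if (j < base)%N then a0 j else
  if insub (j - base)%N is Some k then
    let x : spos := enum_val (k : 'I_#|{: spos}|) in ebase (w x.1 x.2)
  else 0.

Lemma word_point_lt w j : (j < base)%N -> word_point w j = a0 j.
Proof. by rewrite /word_point => ->. Qed.

Lemma word_point_pvar w q p : word_point w (pvar base (q, p)) = ebase (w q p).
Proof.
by rewrite /word_point /pvar ltnNge leq_addr /= addKn valK enum_rankK.
Qed.

Lemma bdet_wblock w x : (forall q, w q \in balanced d N) ->
  bdet (wblock base w x) (word_point w) = 1.
Proof.
move=> bw; rewrite -(det1 F d); congr (\det _); apply/matrixP => i j.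
by rewrite !mxE word_point_pvar occK // v2r_ebase.
Qed.

Lemma bdet_wblock_inj (w w' : 'I_t -> word) (x : 'I_t * 'I_N) (i j : 'I_d) :
  i != j ->
  w' (shift x.1 i) (occ (w (shift x.1 i)) i x.2) =
    w' (shift x.1 j) (occ (w (shift x.1 j)) j x.2) ->
  bdet (wblock base w x) (word_point w') = 0.
Proof.
move=> ij wE; apply: (determinant_alternate ij) => k.
by rewrite !mxE !word_point_pvar wE.
Qed.

(* If w and w' agree on the segments before q, the blocks ending in segment q
   force the letters of w' there to be at least those of w; both segments have
   the same sum of letters. *)
Lemma wblocks_separate (w w' : 'I_t -> word) :
  (forall q, w q \in balanced d N) -> (forall q, w' q \in balanced d N) ->
  (forall q : 'I_t, (q < d)%N -> w' q = w q) ->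
  (forall x, bdet (wblock base w x) (word_point w') != 0) ->
  forall q, w' q = w q.
Proof.
move=> bw bw' ww' nz q.
have [n] := ubnP (val q); elim: n q => // n IH q; rewrite ltnS => qn.
have [/ww' //|dq] := ltnP q d.
(* If the letter dropped from [i] to [j], the block starting at segment [q - i] through this
   position would take its entry for [j] from segment [q - i + j], where [w'] equals [w] by
   induction; two rows would coincide. As [i < d <= q], no wrap-around occurs. *)
have w_le p : (w q p <= w' q p)%N.
  rewrite leqNgt; apply/negP => lt.
  have [r rE] := occ_surj (bw q) p.
  set i := w q p in lt rE; set j := w' q p in lt.
  have iq : (i <= q)%N by rewrite (leq_trans (ltnW (ltn_ord i))).
  have lt_q k : (k <= i)%N -> (q - i + k < t)%N.
    move=> ki; apply: leq_ltn_trans (ltn_ord q).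
    by rewrite -[X in (_ <= X)%N](subnK iq) leq_add2l.
  have q0t : (q - i < t)%N by rewrite -[X in (X < _)%N]addn0 lt_q.
  pose q0 := Ordinal q0t.
  have shi : shift q0 i = q.
    by apply: val_inj; rewrite /= subnK // modn_small.
  have shj : (shift q0 j < q)%N.
    rewrite /= modn_small; last by rewrite lt_q // ltnW.
    by rewrite -[X in (_ < X)%N](subnK iq) ltn_add2l.
  case/eqP: (nz (q0, r)); apply: (@bdet_wblock_inj _ _ _ i j).
    by apply: contraTneq lt => ->; rewrite ltnn.
  rewrite /= shi rE -/j IH ?occK //.
  exact: leq_trans shj qn.
apply/ffunP => p; apply/val_inj/esym/eqP; move: p.
have [_] := leqif_sum (fun p (_ : true) => leqif_eq (w_le p)).
rewrite (sum_balanced (bw q)) (sum_balanced (bw' q)) eqxx => /esym/forallP H p.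
exact: H.
Qed.

End WordPoints.

Hypothesis F0 : [pchar F] =i pred0.
Hypothesis simpleA : simple_algebra mul.
Hypothesis tau_nondegenerate :
  forall u, u != 0 -> exists v, trace_form mul u v != 0.
Hypothesis dim_gt0 : (0 < d)%N.

Lemma trace_form_annihilator u : u != 0 -> exists v, mul u v != 0.
Proof.
move=> /tau_nondegenerate[v uv]; apply: contrapT => /forallNP nu.
case/eqP: uv; apply: ltrace0 => z /=; apply/eqP/negPn/negP.
exact: nu.
Qed.

(** The words are [d] copies of [W0] followed by [t] arbitrary balanced ones. Evaluating the
    products at the points spelled by these sequences gives a nonzero multiple of the identity
    matrix. Even [N] makes the number of blocks even. *)
Lemma codim_ge_balanced : exists base, forall N t, ~~ odd N ->
  (#|balanced d N| ^ t <= codim mul (base + (d + t) * (d * N)))%N.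
Proof.
have neq0A : exists u : A, u != 0.
  pose i0 := Ordinal dim_gt0; exists (ebase i0).
  apply/eqP => /(congr1 (fun u => v2r u 0 i0)).
  by rewrite v2r_ebase linear0 mxE eqxx => /eqP; rewrite oner_eq0.
have [n [g [rg g_first [a0 ga0]]]] :=
  alternating_polynomial F0 simpleA trace_form_annihilator neq0A.
set base := (d + n)%N in rg; exists base => N t evenN.
pose W0 : {ffun 'I_d * 'I_N -> 'I_d} := [ffun p => p.1].
pose I : finType := {ffun 'I_t -> {x | x \in balanced d N}}.
pose w (u : I) (q : 'I_(d + t)) :=
  if fintype.split q is inr j then val (u j) else W0.
have bw u q : w u q \in balanced d N.
  rewrite /w; case: fintype.split => *; first exact: balanced_fst.
  exact: valP.
have w_inj u v : w u =1 w v -> u = v.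
  move=> uv; apply/ffunP => j; apply/val_inj.
  by have := uv (rshift d j); rewrite /w (unsplitK (inr _)).
have w_init u v (q : 'I_(d + t)) : (q < d)%N -> w u q = w v q.
  by rewrite /w; case: split_ordP => // j -> /=; rewrite ltnNge leq_addr.
pose s := [seq pvar base x | x <- enum {: 'I_(d + t) * ('I_d * 'I_N)}]
  ++ iota 0 base.
have us : uniq s.
  rewrite cat_uniq (map_inj_uniq (@pvar_inj _ _ _ _)) enum_uniq iota_uniq.
  rewrite andbT /=.
  apply/hasPn => j; rewrite mem_iota add0n => /= jb.
  by apply/mapP => -[x _ jE]; rewrite jE ltnNge leq_addr in jb.
have size_s : size s = (base + (d + t) * (d * N))%N.
  by rewrite size_cat size_map -cardE !card_prod !card_ord size_iota addnC.
pose Phi u a := bdet (@fblock F A) a *: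
  (\prod_(b <- wblocks base (w u)) bdet b a *: g a).
have rPhi u : realizable mul s (Phi u).
  have ps : perm_eq
      (flatten [seq codom b | b <- wblocks base (w u)] ++ iota 0 base) s.
    rewrite perm_cat2r; exact: wblocks_perm.
  apply: (realizable_perm ps).
  apply: (realizable_blocks (b0 := @fblock F A) val_inj tau_nondegenerate)
    => //.
  - by rewrite size_map -cardE card_prod !card_ord oddM (negbTE evenN) andbF.
  - by rewrite (perm_uniq ps).
  - by move=> i; rewrite mem_iota /= add0n; exact: ltn_addr (ltn_ord i).
  - by move=> a i v; apply: g_first; exact: ltn_ord.
rewrite -size_s.
have <- : (#|I| = #|balanced d N| ^ t)%N by rewrite card_ffun card_ord card_sig.
apply: (codim_ge us rPhi) => c c0 u.
have := c0 (word_point base a0 (w u)).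
have baseE u' : Phi u' (word_point base a0 (w u)) =
    (u' == u)%:R *: (bdet (@fblock F A) a0 *: g a0).
  pose Psi a := bdet (@fblock F A) a *: g a.
  have -> : Phi u' (word_point base a0 (w u)) =
      \prod_(b <- wblocks base (w u')) bdet b (word_point base a0 (w u)) *:
      Psi (word_point base a0 (w u)).
    by rewrite /Phi /Psi !scalerA mulrC.
  have -> : Psi (word_point base a0 (w u)) = Psi a0.
    apply: (realizable_local rg) => j; rewrite mem_iota add0n => /andP[_ jb].
    exact: word_point_lt.
  congr (_ *: _); rewrite big_map big_enum.
  have [->|ne] := eqVneq u' u.
    by rewrite big1 // => x _; exact: bdet_wblock.
  apply/eqP; rewrite prodf_seq_eq0; apply: contra_neqT ne => /hasPn nz.
  apply: w_inj => q; apply/esym; move: q.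
  apply: (@wblocks_separate base _ _ a0) => // [q|x]; first exact: w_init.
  by apply: nz; rewrite mem_index_enum.
under eq_bigr do rewrite baseE.
rewrite (bigD1 u) //= big1 ?addr0 => [|u' /negbTE ->]; last first.
  by rewrite scale0r scaler0.
by rewrite eqxx scale1r => /eqP; rewrite scaler_eq0 (negbTE ga0) orbF => /eqP.
Qed.

(* For N = 2^(k+1), the factor (N+1)^(d^2) lost on each segment of length d N is
   at most 2^((k+2) d^2). *)
Lemma codim_lower_bound k : exists K, forall n, (K <= n)%N ->
  (d ^ n <=
    codim mul n * 2 ^ (k.+2 * (d * d) * (n %/ (d * 2 ^ k.+1))) * d ^ K)%N.
Proof.
have [base baseP] := codim_ge_balanced; pose N := (2 ^ k.+1)%N.
have N_gt0 : (0 < N)%N by rewrite expn_gt0.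
have dN_gt0 : (0 < d * N)%N by rewrite muln_gt0 dim_gt0.
(* Room for the [base] variables, the [d] fixed segments and a remainder shorter than one
   segment. *)
exists (base + d * (d * N) + d * N)%N => n Kn.
pose m := (n - (base + d * (d * N)))%N; pose t := (m %/ (d * N))%N.
have le_n : (base + (d + t) * (d * N) <= n)%N.
  rewrite mulnDl addnA -leq_subRL; last by rewrite (leq_trans _ Kn) // leq_addr.
  by rewrite -/m leq_divM.
have mono i : (i <= n)%N -> (codim mul i <= codim mul n)%N.
  move=> /subnK <-; elim: (n - i)%N => // j; rewrite addSn => /leq_trans; apply.
  exact: codim_le_succ trace_form_annihilator.
have evenN : ~~ odd N by rewrite oddX.
have c_ge := leq_trans (baseP N t evenN) (mono _ le_n).
have leq_exp m1 m2 e : (m1 <= m2)%N -> (m1 ^ e <= m2 ^ e)%N.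
  by move=> m12; elim: e => // e IH; rewrite !expnS leq_mul.
have N2 : (N.+1 <= 2 ^ k.+2)%N.
  by rewrite expnS mul2n -addnn -addn1 leq_add.
have dt : (d ^ (d * N * t) <= codim mul n * 2 ^ (k.+2 * (d * d) * t))%N.
  rewrite expnM; apply: (@leq_trans ((#|balanced d N| * N.+1 ^ (d * d)) ^ t)).
    by apply: leq_exp; exact: card_balanced.
  rewrite expnMn leq_mul // -!expnM -[(k.+2 * _ * _)%N]mulnA.
  rewrite [X in (_ <= X)%N]expnM.
  exact: leq_exp.
have tn : (t <= n %/ (d * N))%N by rewrite leq_div2r // leq_subr.
have n_le : (n <= d * N * t + (base + d * (d * N) + d * N))%N.
  have := ltn_ceil m dN_gt0; rewrite -/t mulSn (mulnC t) /m.
  by move: Kn; lia.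
apply: (@leq_trans (d ^ (d * N * t) * d ^ (base + d * (d * N) + d * N))).
  by rewrite -expnD leq_pexp2l.
rewrite leq_mul // (leq_trans dt) // leq_mul // leq_pexp2l // leq_mul //.
Qed.

End Growth.

(** * The limit *)

(** At [j = k.+1] this bounds the loss [k.+2 / 2 ^ k.+1] by [4 / k.+2]. *)
Lemma sqr_le_exp2 j : (j.+1 ^ 2 <= 4 * 2 ^ j)%N.
Proof.
case: j => [|[|j]] //; elim: j => [|j IH] //.
by rewrite [(2 ^ j.+3)%N]expnS; move: IH; rewrite !expnS !expn0; nia.
Qed.

Section RootLimit.
Variables (R : realType) (c : nat -> nat) (d : nat).
Hypothesis d_gt0 : (0 < d)%N.
Hypothesis c_le : forall n, (c n <= d ^ n * d)%N.
Hypothesis c_ge : forall k, exists K, forall n, (K <= n)%N ->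
  (d ^ n <= c n * 2 ^ (k.+2 * (d * d) * (n %/ (d * 2 ^ k.+1))) * d ^ K)%N.

Let D : R := d%:R.
Let D_gt0 : 0 < D. Proof. by rewrite ltr0n. Qed.
Let lnD_ge0 : 0 <= ln D. Proof. by rewrite ln_ge0 // ler1n. Qed.

Let c_gt0 : exists K, forall n, (K <= n)%N -> (0 < c n)%N.
Proof.
have [K Kle] := c_ge 0; exists K => n /Kle; case: (c n) => // .
by rewrite !mul0n leqn0 expn_eq0 eqn0Ngt d_gt0.
Qed.

Lemma ln_le_upper n : (0 < c n)%N -> ln ((c n)%:R : R) <= n%:R * ln D + ln D.
Proof.
move=> cn; rewrite mulr_natl -lnXn // -lnM ?posrE ?exprn_gt0 //.
by rewrite ler_ln ?posrE ?mulr_gt0 ?exprn_gt0 ?ltr0n // -natrX -natrM ler_nat.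
Qed.

Lemma ln_ge_lower k : exists K, forall n, (K <= n)%N -> (0 < c n)%N ->
  n%:R * ln D <= ln ((c n)%:R : R) + n%:R * (4 * D / k.+2%:R) + K%:R * ln D.
Proof.
have [K Kle] := c_ge k; exists K => n /Kle cn cn0.
set E := (k.+2 * (d * d) * (n %/ (d * 2 ^ k.+1)))%N in cn.
have : ln (D ^+ n) <= ln ((c n)%:R * 2 ^+ E * D ^+ K).
  rewrite ler_ln ?posrE ?mulr_gt0 ?exprn_gt0 ?ltr0n //.
  by rewrite -!natrX -!natrM ler_nat.
rewrite !lnM ?posrE ?mulr_gt0 ?exprn_gt0 ?ltr0n // !lnXn //.
rewrite -[ln D *+ n]mulr_natl -[ln 2 *+ E]mulr_natl -[ln D *+ K]mulr_natl.
move/le_trans; apply; rewrite lerD2r lerD2l.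
apply: (@le_trans _ _ (E%:R * 1)).
  by rewrite ler_wpM2l // (_ : 2 = 1 + 1) ?le_ln1Dx // ltrN10.
rewrite mulr1.
have D0 : D != 0 by rewrite gt_eqF.
have P0 : (2 ^+ k.+1 : R) != 0 by rewrite expf_neq0 // pnatr_eq0.
have : (n %/ (d * 2 ^ k.+1))%:R * (D * 2 ^+ k.+1) <= n%:R :> R.
  by rewrite -natrX -!natrM ler_nat leq_divM.
rewrite -ler_pdivlMr ?mulr_gt0 ?exprn_gt0 // => nq.
rewrite /E !natrM -/D.
apply: (@le_trans _ _ (k.+2%:R * (D * D) * (n%:R / (D * 2 ^+ k.+1)))).
  by rewrite ler_wpM2l // !mulr_ge0 // ltW.
have -> : k.+2%:R * (D * D) * (n%:R / (D * 2 ^+ k.+1)) =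
    n%:R * (D * (k.+2%:R / 2 ^+ k.+1)) :> R by field; rewrite D0 P0.
rewrite ler_wpM2l // [leRHS](_ : _ = D * (4 / k.+2%:R)); last first.
  by rewrite mulrCA mulrA.
rewrite ler_wpM2l ?(ltW D_gt0) //.
rewrite ler_pdivrMr ?exprn_gt0 // mulrAC ler_pdivlMr ?ltr0n //.
rewrite -natrX -!natrM ler_nat.
by have := sqr_le_exp2 k.+1; rewrite expnS expn1.
Qed.

Lemma root_limit :
  (((c n)%:R `^ (n%:R^-1) : R) @[n --> \oo] --> (d%:R : R))%classic.
Proof.
have lnlim : ((ln ((c n)%:R : R) / n%:R) @[n --> \oo] --> ln D)%classic.
  apply/cvgrPdist_le => e e0.
  (* This makes the loss per variable at most [e / 2]; [M] then makes the constant terms, up to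
     [K.+1] times [ln D], at most [n * e / 2]. *)
  pose k := Num.bound (8 * D / e).
  have [K lower] := ln_ge_lower k; have [K0 c0] := c_gt0.
  pose M := Num.bound (2 * (K.+1)%:R * ln D / e).
  near=> n.
  have cn : (0 < c n)%N by apply: c0; near: n; exact: nbhs_infty_ge.
  have n0 : 0 < n%:R :> R by rewrite ltr0n; near: n; exact: nbhs_infty_gt.
  have up := ln_le_upper cn.
  have lo : n%:R * ln D <=
      ln ((c n)%:R : R) + n%:R * (4 * D / k.+2%:R) + K%:R * ln D.
    by apply: lower => //; near: n; exact: nbhs_infty_ge.
  have Mn : 2 * (K.+1)%:R * ln D / e <= n%:R.
    apply: (@le_trans _ _ M%:R).
      apply: ltW; apply: archi_boundP.
      by rewrite divr_ge0 ?mulr_ge0 ?(ltW e0).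
    by rewrite ler_nat; near: n; exact: nbhs_infty_ge.
  have ke : 4 * D / k.+2%:R <= e / 2.
    have : 8 * D / e < k.+2%:R.
      apply: (lt_le_trans (archi_boundP _)); last first.
        by rewrite ler_nat; exact: leqW (leqnSn _).
      by rewrite divr_ge0 ?mulr_ge0 // ltW.
    rewrite ltr_pdivrMr // => ke; rewrite ler_pdivrMr ?ltr0n //; lra.
  move: Mn; rewrite ler_pdivrMr // -natr1 => Mn.
  set l := ln D in up lo Mn *; set x := ln _ in up lo *.
  have lo' : n%:R * l <= x + n%:R * (e / 2) + K%:R * l.
    by apply: (le_trans lo); rewrite lerD2r lerD2l ler_wpM2l // ltW.
  have Kl : 0 <= K%:R * l by rewrite mulr_ge0.
  have l0 : 0 <= l := lnD_ge0.
  rewrite ler_distlC; apply/andP; split.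
    by rewrite ler_pdivlMr //; lra.
  by rewrite ler_pdivrMr //; lra.
rewrite -[d%:R]lnK ?posrE //.
(* The root is the exponential of [ln (c n) / n] as soon as [c n] is positive. *)
apply: cvg_trans (continuous_cvg _ (@continuous_expR R (ln D)) lnlim).
have [K0 c0] := c_gt0; apply: near_eq_cvg; near=> n.
have cn : (0 < c n)%N by apply: c0; near: n; exact: nbhs_infty_ge.
by rewrite /powR pnatr_eq0 gtn_eqF // mulrC.
Unshelve. all: end_near.
Qed.

End RootLimit.

Local Open Scope classical_set_scope.

Theorem theorem4p2 (R : realType) (F : closedFieldType)
    (charF0 : [pchar F] =i pred0) (B : vectType F)
    (br : {bilinear B -> B -> B}) (simpleB : is_simple_lie br) :
  ((codim (color_bracket br) n)%:R `^ (n%:R^-1) : R) @[n --> \oo]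
    --> ((\dim {: FG_tensor B})%:R : R).
Proof.
have dim_gt0 : (0 < dim (FG_tensor B))%N.
  have [_ [x [y xy]] _] := simpleB.
  rewrite -dimvf lt0n dimv_eq0; apply: contra xy => /eqP full0.
  have /ffunP/(_ 0) : tens (group_elt F 0) (br x y) = 0.
    by apply/eqP; rewrite -memv0 -full0 memvf.
  by rewrite tensE eqxx ffunE => ->.
have simpleL : simple_algebra (color_bracket br).
  exact: color_bracket_simple charF0 simpleB.
have nondeg := color_trace_nondegenerate charF0 simpleB.
rewrite dimvf; apply: root_limit => // [n|k].
  exact: codim_le.
exact: (codim_lower_bound charF0 simpleL nondeg dim_gt0).
Qed.
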